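(* For every $n$ and every $n$-point metric with doubling dimension $d$, there is a 3-hop routing scheme with stretch $(1+\varepsilon)$ that uses $O_{\varepsilon,d}(\log^2 n/\log\log n)$ bits per vertex.
   Context: A routing scheme for a metric $M$ on point set $V$ chooses an overlay network (a graph on $V$, edges weighted by metric distance) and assigns each vertex a routing table and a label; a packet to destination $v$ carries a header with the label of $v$, and at each vertex the next edge (port) is determined from that vertex's table and the header. It has stretch $t$ if every routed path has length at most $t$ times the distance, and is 3-hop if every routed path uses at most 3 edges. Bits per vertex count table and label. $\varepsilon\in(0,1)$ is a parameter; doubling dimension is the standard notion; $O_{\varepsilon,d}$ hides factors depending only on $\varepsilon$ and $d$. *)

(* Defs.v *)
From HB Require Import structures.
From mathcomp Require Import all_boot all_order all_algebra.
From mathcomp Require Import boolp reals exp.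

Set Implicit Arguments.
Unset Strict Implicit.
Unset Printing Implicit Defensive.

Import Order.TTheory GRing.Theory Num.Theory.
Local Open Scope ring_scope.

(* The library's [metricType] bundles a topology and does not combine with
   [finType], hence this bare structure. *)
Record finite_metric (R : realType) (V : finType) := FiniteMetric {
  dist :> V -> V -> R;
  dist_eq0 : forall x y, (dist x y == 0) = (x == y);
  dist_sym : forall x y, dist x y = dist y x;
  dist_triangle : forall x y z, dist x z <= dist x y + dist y z }.

Definition cball (R : realType) (V : finType) (M : finite_metric R V)
  (x : V) (r : R) : {set V} := [set y | M x y <= r].

Definition half_coverable (R : realType) (V : finType) (M : finite_metric R V)
  (k : nat) : Prop :=
  forall (x : V) (r : R), 0 < r ->
    exists2 C : {set V}, (#|C| <= k)%N &
      cball M x r \subset \bigcup_(c in C) cball M c (r / 2).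

Lemma half_coverable_card (R : realType) (V : finType)
  (M : finite_metric R V) : half_coverable M #|V|.
Proof.
move=> x r r0; exists [set: V]; first by rewrite cardsT.
apply/subsetP => y _; apply/bigcupP; exists y; rewrite ?inE //.
have /eqP -> : M y y == 0 by rewrite dist_eq0.
by rewrite divr_ge0 // ltW.
Qed.

Lemma ex_half_coverable (R : realType) (V : finType) (M : finite_metric R V) :
  exists k, `[< half_coverable M k >].
Proof. by exists #|V|; apply/asboolP; exact: half_coverable_card. Qed.

Definition doubling_constant (R : realType) (V : finType)
  (M : finite_metric R V) : nat := ex_minn (ex_half_coverable M).

Definition log2 (R : realType) (x : R) : R := ln x / ln 2.

Definition doubling_dimension (R : realType) (V : finType)
  (M : finite_metric R V) : R := log2 (doubling_constant M)%:R.

Record overlay (V : finType) := Overlay {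
  edge :> rel V;
  edge_sym : symmetric edge;
  edge_irr : irreflexive edge }.

(* [port u w] is the name, in {0, ..., deg u - 1}, that [u] uses for the edge
   leading to its neighbour [w]; it is irrelevant when [u w] is not an edge. *)
Record port_numbering (V : finType) (E : overlay V) := PortNumbering {
  port :> V -> V -> nat;
  port_inj : forall u w1 w2,
    E u w1 -> E u w2 -> port u w1 = port u w2 -> w1 = w2;
  port_lt_deg : forall u w, E u w -> (port u w < #|[set x | E u x]|)%N }.

(* The header of a packet: the label of its destination, and auxiliary
   information written by the source. It does not change along the route. *)
Definition header := (seq bool * seq bool)%type.

(* The local rules executed by the vertices. They see nothing but bit strings,
   so everything that depends on the metric, on the overlay network and on the
   ports has to be stored in the tables and the labels. *)
Record routing_rules := RoutingRules {
  (* table of the source -> label of the destination -> auxiliary bits *)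
  aux_bits : seq bool -> seq bool -> seq bool;
  (* table of the current vertex -> header -> port to take next, or [None] if
     the packet has reached its destination *)
  forward : seq bool -> header -> option nat }.

Record assignment (V : finType) := Assignment {
  table : V -> seq bool;
  label : V -> seq bool }.

Section Routing.
Variables (R : realType) (V : finType) (M : finite_metric R V).
Variables (A : routing_rules) (E : overlay V) (P : port_numbering E).
Variable S : assignment V.

Definition packet_header (u v : V) : header :=
  (label S v, aux_bits A (table S u) (label S v)).

Definition hop (h : header) : rel V :=
  fun w w' => E w w' && (forward A (table S w) h == Some (P w w')).

(* The packet from [u] to [v] visits [u :: s] in this order and is then
   delivered at [v]. *)
Definition routed_path (u v : V) (s : seq V) : bool :=
  let h := packet_header u v in
  [&& path (hop h) u s, last u s == v & forward A (table S v) h == None].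

Fixpoint path_length (u : V) (s : seq V) : R :=
  if s is w :: s' then M u w + path_length w s' else 0.

Definition delivers : Prop := forall u v, exists s, routed_path u v s.

Definition hop_bounded (k : nat) : Prop :=
  forall u v s, routed_path u v s -> (size s <= k)%N.

Definition has_stretch (t : R) : Prop :=
  forall u v s, routed_path u v s -> path_length u s <= t * M u v.

Definition vertex_bits (u : V) : nat := (size (table S u) + size (label S u))%N.

Definition header_bits (u v : V) : nat :=
  (size (packet_header u v).1 + size (packet_header u v).2)%N.

End Routing.

(* For n <= 2 the quotient is undefined (log log n is undefined or 0); the
   value 1 is used there, so that O(.) means O(1). *)
Definition log_sq_over_loglog (R : realType) (n : nat) : R :=
  if (n <= 2)%N then 1 else log2 n%:R ^+ 2 / log2 (log2 n%:R).

(* Main.v *)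
Require Import Defs.
From HB Require Import structures.
From mathcomp Require Import all_boot all_order all_algebra.
From mathcomp Require Import reals.
From mathcomp Require Import boolp sequences exp.
From mathcomp Require Import zify ring lra.

(** Locality-sensitive orderings reduce the problem to the line. Take nets at
    the scales r Q^i, color each net so that net points of one color are far
    apart, and for each color form a laminar hierarchy of clusters by letting a
    level-i cluster join the net point of that color within 3 r Q^(i+1) if there
    is one. Every cluster has boundedly many children, and every pair x, y is
    separated, in some hierarchy, inside a cluster of diameter O(d(x,y)) whose
    children have diameter at most eps d(x,y) / 4. Ordering the children so that
    a prescribed pair of them comes first yields boundedly many linear orders
    such that for every pair x, y, in one of them, the vertices from x to y form
    an interval close to x followed by an interval close to y. Any monotone
    path from x to y in that order has stretch at most 1 + eps.

    In one order, write ranks in base k, about sqrt(log n), with O(log n / log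
    log n) digits. If e is the highest digit where u and v differ, route
    u -> s1 -> s2 -> v, where s1 is the first multiple of k^e after u and s2 the
    last one before v. The vertex u knows its s1 for each e, the label of v
    names s2 for each e, and s1, a first separator for one e only, stores the
    ports to its k siblings. The overlay is the complete graph.

    The source must also find an order that is good for v. The good pairs of an
    order form disjoint products of two consecutive intervals, so for each e it
    suffices that u and v store one rank and one bit per sibling. *)

Set Implicit Arguments.
Unset Strict Implicit.
Unset Printing Implicit Defensive.

Import Order.TTheory GRing.Theory Num.Theory.
Local Open Scope ring_scope.

(** * Prefix codes and nets *)

Section PrefixCodes.
Local Open Scope nat_scope.

Definition prefix_code (T : Type) (c : T -> seq bool) : Prop :=
  forall x y s t, c x ++ s = c y ++ t -> x = y /\ s = t.

Definition code_bool (b : bool) : seq bool := [:: b].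

Definition code_pair (T U : Type) (c : T -> seq bool) (c' : U -> seq bool)
  (p : T * U) : seq bool := c p.1 ++ c' p.2.

(** A continuation bit precedes every item and [false] ends the list, which makes the code
    self-delimiting. *)
Fixpoint code_seq (T : Type) (c : T -> seq bool) (s : seq T) : seq bool :=
  if s is x :: s' then true :: c x ++ code_seq c s' else [:: false].

(** Binary digits, least significant first; [fuel] only bounds the recursion, and any value at least
    [n] suffices. *)
Fixpoint digits (fuel n : nat) : seq bool :=
  if fuel is f.+1 then if n == 0 then [::] else odd n :: digits f n./2
  else [::].

Definition code_nat (n : nat) : seq bool := code_seq code_bool (digits n n).

Lemma prefix_code_bool : prefix_code code_bool.
Proof. by move=> x y s t [-> ->]. Qed.

Lemma prefix_code_pair (T U : Type) (c : T -> seq bool) (c' : U -> seq bool) :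
  prefix_code c -> prefix_code c' -> prefix_code (code_pair c c').
Proof.
move=> hc hc' [x x'] [y y'] s t; rewrite /code_pair /= -!catA.
by move=> /hc [-> /hc' [-> ->]].
Qed.

Lemma prefix_code_seq (T : Type) (c : T -> seq bool) :
  prefix_code c -> prefix_code (code_seq c).
Proof.
move=> hc; elim=> [|x s IH] [|y s'] t t' //=.
- by move=> [->].
- by case; rewrite -!catA => /hc [-> /IH [-> ->]].
Qed.

Lemma digits_inj f g n m : n <= f -> m <= g ->
  digits f n = digits g m -> n = m.
Proof.
elim: f g n m => [|f IH] [|g] n m //=; try by case: n m => [|n] [|m].
case: eqP => [->|n0]; case: eqP => [->|m0] // hn hm [ho /IH h].
rewrite -(odd_double_half n) -(odd_double_half m) ho h //.
  by rewrite -ltnS (leq_trans _ hn) // ltn_half_double; lia.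
by rewrite -ltnS (leq_trans _ hm) // ltn_half_double; lia.
Qed.

Lemma size_digits f n w : n < 2 ^ w -> size (digits f n) <= w.
Proof.
elim: f n w => [|f IH] n [|w] //=; first by case: n.
rewrite expnS => h; case: eqP => //= _; rewrite ltnS; apply: IH; lia.
Qed.

Lemma prefix_code_nat : prefix_code code_nat.
Proof.
move=> x y s t /(prefix_code_seq prefix_code_bool)[h ->].
by split=> //; apply: digits_inj h.
Qed.

Lemma size_code_seq (T U : Type) (c : U -> seq bool) (f : T -> U) s b :
  (forall x, size (c (f x)) <= b) ->
  size (code_seq c [seq f x | x <- s]) <= (size s * b.+1).+1.
Proof.
move=> h; elim: s => //= x s IH; rewrite size_cat.
by have := h x; lia.
Qed.

(** Each of the at most [w] digits costs two bits, and the end marker one. *)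
Lemma size_code_nat n w : n < 2 ^ w -> size (code_nat n) <= w.*2.+1.
Proof.
move=> /(size_digits n) h; rewrite /code_nat -(map_id (digits n n)).
by apply: leq_trans (size_code_seq (b := 1) _ _) _ => //; lia.
Qed.

(* Reading a bit string needs no algorithm: any left inverse of an injective
   code will do. *)
Definition decode (T : Type) (x0 : T) (c : T -> seq bool) (s : seq bool) : T :=
  if pselect (exists x, c x = s) is left h then projT1 (cid h) else x0.

Lemma decodeK (T : Type) (x0 : T) (c : T -> seq bool) :
  prefix_code c -> cancel c (decode x0 c).
Proof.
move=> hc x; rewrite /decode; case: pselect => [h|[]]; last by exists x.
case: (cid h) => y /= e.
by have [] := hc y x [::] [::] (congr1 (cat^~ [::]) e).
Qed.

End PrefixCodes.

(** * Packing bounds, nets and greedy coloring *)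

Section Packing.
Variables (R : realType) (V : finType) (M : finite_metric R V).

Lemma dist_xx x : M x x = 0.
Proof. by apply/eqP; rewrite dist_eq0. Qed.

Lemma dist_ge0 x y : 0 <= M x y.
Proof.
have := dist_triangle M x y x; rewrite dist_xx (dist_sym M y x); lra.
Qed.

Lemma dist_gt0 x y : x != y -> 0 < M x y.
Proof. by move=> xy; rewrite lt_def dist_ge0 dist_eq0 xy. Qed.

Lemma half_coverable_iter k (h : nat) x r : half_coverable M k -> 0 < r ->
  exists2 C : {set V}, (#|C| <= k ^ h)%N &
    cball M x r \subset \bigcup_(c in C) cball M c (r / 2 ^+ h).
Proof.
move=> hk r0; elim: h => [|h [C hC sC]].
  by exists [set x]; rewrite ?cards1 // big_set1 expr0 divr1.
have r'0 : 0 < r / 2 ^+ h by rewrite divr_gt0 // exprn_gt0.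
pose F c := s2val (cid2 (hk c _ r'0)).
have F1 c : (#|F c| <= k)%N by rewrite /F; case: cid2.
have F2 c : cball M c (r / 2 ^+ h) \subset
    \bigcup_(c' in F c) cball M c' (r / 2 ^+ h / 2) by rewrite /F; case: cid2.
exists (\bigcup_(c in C) F c).
  apply: leq_trans (_ : _ <= \sum_(c in C) #|F c|)%N _.
    elim/big_rec2: _ => [|c m S _ le_Sm]; first by rewrite cards0.
    by rewrite (leq_trans (leq_card_setU _ _).1) ?leq_add2l.
  apply: (@leq_trans (\sum_(c in C) k)); first exact: leq_sum.
  by rewrite sum_nat_const expnSr leq_mul2r hC orbT.
apply: (subset_trans sC); apply/bigcupsP => c cC.
apply: (subset_trans (F2 c)); apply/bigcupsP => c' c'F.
have -> : r / 2 ^+ h.+1 = r / 2 ^+ h / 2.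
  by rewrite exprSr invfM mulrA.
by apply: bigcup_sup; apply/bigcupP; exists c.
Qed.

Definition separated (r : R) (S : {set V}) :=
  [forall a in S, forall b in S, (a != b) ==> (r < M a b)].

Lemma separatedP r (S : {set V}) : reflect
  (forall a b, a \in S -> b \in S -> a != b -> r < M a b) (separated r S).
Proof.
apply: (iffP forall_inP) => [h a b aS bS ab|h a aS].
  by have /forall_inP/(_ b bS)/implyP := h a aS; apply.
by apply/forall_inP => b bS; apply/implyP; exact: h.
Qed.

(** Halving [h] times covers the ball by [k ^ h] balls of diameter at most [s], and each of them
    holds at most one point of [S]. *)
Lemma card_separated k h x (r s : R) (S : {set V}) :
  half_coverable M k -> 0 < r -> 2 * r <= s * 2 ^+ h ->
  separated s S -> S \subset cball M x r -> (#|S| <= k ^ h)%N.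
Proof.
move=> hk r0 hrs /separatedP hS sS.
have [C hC sC] := half_coverable_iter h x hk r0.
have cov y : y \in S -> exists2 c, c \in C & M c y <= r / 2 ^+ h.
  move=> /(subsetP sS) /(subsetP sC) /bigcupP[c cC].
  by rewrite inE; exists c.
pose f y := odflt y [pick c in C | M c y <= r / 2 ^+ h].
have fP y : y \in S -> f y \in C /\ M (f y) y <= r / 2 ^+ h.
  move=> yS; rewrite /f; case: pickP => [c /andP[]//|/=].
  by have [c cC hc] := cov y yS => /(_ c); rewrite cC hc.
rewrite -(card_in_imset (f := f) (D := S)).
  apply: leq_trans hC; apply/subset_leq_card/subsetP => _ /imsetP[y yS ->].
  by case: (fP y yS).
move=> a b aS bS fab; apply/eqP; apply: contraT => ab.
have := hS a b aS bS ab.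
have [_ ha] := fP a aS; have [_ hb] := fP b bS.
have := dist_triangle M a (f a) b; rewrite (dist_sym M a (f a)) {2}fab.
have : 2 * (r / 2 ^+ h) <= s.
  by rewrite mulrA ler_pdivrMr // exprn_gt0.
lra.
Qed.

(** A separated set of maximal cardinality covers: a point far from all of it could be added. *)
Lemma ex_net (r : R) : 0 <= r -> exists2 N : {set V},
  separated r N & forall x, exists2 c, c \in N & M x c <= r.
Proof.
move=> r0.
have s0 : separated r set0 by apply/separatedP => a b; rewrite inE.
case: (@arg_maxnP _ set0 (separated r) (fun S => #|S|) s0) => N sN maxN.
exists N => // x.
case: (boolP [exists c in N, M x c <= r]) => [/exists_inP[c cN h]|].
  by exists c.
move=> /exists_inPn far; exfalso.
have xN : x \notin N by apply/negP => /far; rewrite dist_xx r0.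
have : separated r (x |: N).
  apply/separatedP => a b /setU1P[->|aN] /setU1P[->|bN].
  - by rewrite eqxx.
  - by move=> _; rewrite ltNge far.
  - by move=> _; rewrite dist_sym ltNge far.
  - exact: (separatedP _ _ sN).
by move=> /maxN; rewrite cardsU1 xN; lia.
Qed.

End Packing.

(** Greedy coloring: the neighbours of the last vertex use at most [T] of the [T.+1] colors. *)
Lemma ex_coloring (V : finType) (e : rel V) (N : {set V}) (T : nat) :
  symmetric e -> (forall a, a \in N -> #|[set b in N | e a b]| <= T)%N ->
  exists col : V -> 'I_T.+1, forall a b, a \in N -> b \in N -> a != b ->
    e a b -> col a != col b.
Proof.
move=> es; elim: {N}_.+1 {-2}N (ltnSn #|N|) => // n IH N hN hT.
have [->|[x xN]] := set_0Vmem N.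
  by exists (fun=> ord0) => a b; rewrite inE.
have [||col hcol] := IH (N :\ x).
- by rewrite (cardsD1 x) xN in hN; lia.
- move=> a /setD1P[_ aN]; apply: leq_trans (hT a aN).
  by apply/subset_leq_card/subsetP => b; rewrite !inE => /andP[/andP[_ ->] ->].
have [c hc] : exists c, c \notin [set col b | b in [set b in N | e x b]].
  apply/existsP; rewrite -negb_forall; apply/negP => /forallP h.
  have : (T.+1 <= #|[set col b | b in [set b in N | e x b]]|)%N.
    rewrite -[X in (X <= _)%N]card_ord -cardsT.
    by apply/subset_leq_card/subsetP => c _; exact: h.
  apply/negP; rewrite -ltnNge ltnS.
  exact: leq_trans (leq_imset_card _ _) (hT x xN).
have hcb b : b \in N -> e x b -> c != col b.
  move=> bN xb; apply: contraNneq hc => ->.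
  by apply/imsetP; exists b; rewrite // !inE bN.
exists (fun a => if a == x then c else col a) => a b aN bN ab eab.
case: (altP (a =P x)) => [ax|nax]; case: (altP (b =P x)) => [bx|nbx].
- by move: ab; rewrite ax bx eqxx.
- by apply: hcb; rewrite // -ax.
- by rewrite eq_sym; apply: hcb; rewrite // es -bx.
- by apply: hcol; rewrite // !inE ?nax ?nbx.
Qed.

(** * Cluster hierarchies *)

Section Hierarchy.
Variables (R : realType) (V : finType) (M : finite_metric R V).
Variables (net : R -> {set V}) (T : nat) (color : R -> V -> 'I_T.+1).
Hypothesis net_sep : forall r, 0 <= r -> separated M r (net r).
Hypothesis net_cover :
  forall r x, 0 <= r -> exists2 c, c \in net r & M x c <= r.
Hypothesis color_sep : forall r a b, 0 <= r -> a \in net r -> b \in net r ->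
  a != b -> M a b <= 6 * r -> color r a != color r b.

Definition parent (t : 'I_T.+1) (r : R) (q : V) : V :=
  if [pick c in net r | (color r c == t) && (M q c <= 3 * r)] is Some c then c
  else odflt q [pick c in net r | M q c <= r].

Lemma parentP t r q : 0 <= r ->
  parent t r q \in net r /\ M q (parent t r q) <= 3 * r.
Proof.
move=> r0; rewrite /parent; case: pickP => [c /and3P[-> _ ->]//|_].
case: pickP => [c /andP[-> h]|h] /=; first by split=> //; lra.
by have [c cN hc] := net_cover q r0; move: (h c); rewrite cN hc.
Qed.

(** Two candidates within [3 * r] of [q] are within [6 * r] of each other, so they cannot share the
    color [t]. *)
Lemma parent_eq t r q c : 0 <= r -> c \in net r -> color r c = t ->
  M q c <= 3 * r -> parent t r q = c.
Proof.
move=> r0 cN ct qc; rewrite /parent.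
case: pickP => [c' /and3P[c'N /eqP c't qc']|h].
  apply/eqP; apply: contraT => cc'.
  have : color r c' != color r c.
    apply: color_sep => //.
    by have := dist_triangle M c' q c; rewrite (dist_sym M c' q); lra.
  by rewrite c't ct eqxx.
by move: (h c); rewrite cN ct eqxx qc.
Qed.

Variables (r0 Q : R) (L : nat).
Hypotheses (r0_gt0 : 0 < r0) (Q_ge4 : 4 <= Q).

Definition scale (i : nat) : R := r0 * Q ^+ i.

Lemma scale_gt0 i : 0 < scale i.
Proof.
by apply: mulr_gt0 => //; apply: exprn_gt0; apply: lt_le_trans Q_ge4.
Qed.

Lemma scale_ge0 i : 0 <= scale i. Proof. exact/ltW/scale_gt0. Qed.

Lemma scaleS i : scale i.+1 = Q * scale i.
Proof. by rewrite /scale exprS mulrCA. Qed.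

Hypothesis r0_small : forall x y, x != y -> r0 < M x y.
Hypothesis L_large : forall x y, M x y <= scale L.

Fixpoint cluster (t : 'I_T.+1) (i : nat) (x : V) : V :=
  if i is i'.+1 then parent t (scale i) (cluster t i' x) else x.

Lemma cluster_net t i x : cluster t i x \in net (scale i).
Proof.
case: i => [|i] /=.
  2: by have [] := parentP t (cluster t i x) (scale_ge0 i.+1).
(* At level 0 every vertex is a net point, because [r0] is below all positive distances. *)
have [c cN hc] := net_cover x (scale_ge0 0).
suff -> : x = c by [].
apply/eqP; apply: contraT => /r0_small.
by move: hc; rewrite /scale expr0 mulr1; lra.
Qed.

(** By induction: [4 * scale i + 3 * scale i.+1 <= 4 * scale i.+1], because [Q] is at least 4. *)
Lemma cluster_radius t i x : M x (cluster t i x) <= 4 * scale i.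
Proof.
elim: i => [|i IH] /=; first by rewrite dist_xx; have := scale_ge0 0; lra.
have [_ h] := parentP t (cluster t i x) (scale_ge0 i.+1).
have := dist_triangle M x (cluster t i x)
  (parent t (scale i.+1) (cluster t i x)).
have : 4 * scale i <= scale i.+1.
  by rewrite scaleS ler_wpM2r // scale_ge0.
by lra.
Qed.

Lemma cluster_top t x y : cluster t L x = cluster t L y.
Proof.
apply/eqP; apply: contraT => xy.
have := net_sep (scale_ge0 L); move=> /separatedP/(_ _ _ (cluster_net t L x)).
move=> /(_ _ (cluster_net t L y) xy).
by have := L_large (cluster t L x) (cluster t L y); lra.
Qed.

Lemma cluster_up t i j x y : (i <= j)%N ->
  cluster t i x = cluster t i y -> cluster t j x = cluster t j y.
Proof.
by move=> /subnK <- h; elim: (j - i)%N => //= k ->.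
Qed.

(* The color [t] is that of the net point closest to [x]. *)
Lemma cluster_padded i x : exists t, forall y, M x y <= scale i.+1 ->
  cluster t i.+1 x = cluster t i.+1 y.
Proof.
have [c cN hc] := net_cover x (scale_ge0 i.+1).
exists (color (scale i.+1) c).
suff h y : M x y <= scale i.+1 -> cluster (color (scale i.+1) c) i.+1 y = c.
  by move=> y /h ->; apply: h; rewrite dist_xx scale_ge0.
move=> hy; rewrite /=; apply: parent_eq => //; first exact: scale_ge0.
set q := cluster _ i y.
(* Going from [q] to [c] through [y] and [x] costs [4 * scale i] plus twice [scale i.+1], which fits
   in the joining radius [3 * scale i.+1] of [parent]. *)
have := cluster_radius (color (scale i.+1) c) i y; rewrite -/q (dist_sym M y q).
have := dist_triangle M q y c; have := dist_triangle M y x c.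
rewrite (dist_sym M y x).
have : 4 * scale i <= scale i.+1.
  by rewrite scaleS ler_wpM2r // scale_ge0.
by lra.
Qed.

Variable K : nat.

Definition siblings (t : 'I_T.+1) (i : nat) (q : V) : {set V} :=
  [set q' in net (scale i) |
    parent t (scale i.+1) q' == parent t (scale i.+1) q].

Hypothesis siblings_le : forall t i q, (#|siblings t i q| <= K)%N.

Definition child_index (t : 'I_T.+1) (i : nat) (q : V) : nat :=
  index q (enum (siblings t i q)).

Lemma child_index_lt t i x : (child_index t i (cluster t i x) < K)%N.
Proof.
apply: leq_trans (siblings_le t i (cluster t i x)).
by rewrite /child_index cardE index_mem mem_enum inE cluster_net eqxx.
Qed.

Lemma child_index_inj t i x y : cluster t i.+1 x = cluster t i.+1 y ->
  child_index t i (cluster t i x) = child_index t i (cluster t i y) ->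
  cluster t i x = cluster t i y.
Proof.
move=> /= e; rewrite /child_index.
have -> : siblings t i (cluster t i x) = siblings t i (cluster t i y).
  by apply/setP => q; rewrite !inE e.
by apply: (@index_inj _ y); rewrite mem_enum inE cluster_net ?e eqxx.
Qed.

(** Moves [a] to the front and [b] right behind it; the shift by 2 of the other indices keeps the
    map injective. *)
Definition swap_rank (a b c : nat) : nat :=
  if c == a then 0%N else if c == b then 1%N else c.+2.

Lemma swap_rank_inj a b : injective (swap_rank a b).
Proof.
move=> c d; rewrite /swap_rank.
by do 4?[case: eqP => ?]; congruence.
Qed.

Variables (t : 'I_T.+1) (a b : nat).

Definition digit (i : nat) (x : V) : nat :=
  swap_rank a b (child_index t i (cluster t i x)).

Lemma digit_lt i x : (digit i x < K.+2)%N.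
Proof.
have := child_index_lt t i x; rewrite /digit /swap_rank.
by do 2?[case: eqP => _]; lia.
Qed.

(** Horner's scheme in base [K.+2] over the levels from [L - 1] down to [L - k]. Comparing values is
    comparing root-to-leaf paths lexicographically, so every cluster is an interval of [key]. *)
Fixpoint top_digits (k : nat) (x : V) : nat :=
  if k is k'.+1 then (top_digits k' x * K.+2 + digit (L - k) x)%N else 0%N.

Lemma top_digits_ltS k x y : (top_digits k x < top_digits k y)%N ->
  (top_digits k.+1 x < top_digits k.+1 y)%N.
Proof.
move=> /= h; have := digit_lt (L - k.+1) x.
by move: (digit _ x) (digit _ y) h => *; nia.
Qed.

Lemma top_digits_mono k l x y : (k <= l)%N ->
  (top_digits l x <= top_digits l y)%N -> (top_digits k x <= top_digits k y)%N.
Proof.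
move=> /subnK <-; rewrite leqNgt => /negP h; rewrite leqNgt; apply/negP => h'.
apply: h; move: h'.
by elim: (l - k)%N => // m IH /IH h; rewrite addSn; exact: top_digits_ltS.
Qed.

Lemma top_digits_eq k x y : (k <= L)%N ->
  (top_digits k x = top_digits k y <->
   cluster t (L - k) x = cluster t (L - k) y).
Proof.
elim: k => [|k IH] kL; first by rewrite subn0; split=> // _; exact: cluster_top.
have eL : (L - k = (L - k.+1).+1)%N by lia.
split=> [/= h|h].
- have := digit_lt (L - k.+1) x; have := digit_lt (L - k.+1) y => hy hx.
  have hk : top_digits k x = top_digits k y by nia.
  apply: child_index_inj; first by rewrite -eL; apply/IH => //; exact: ltnW.
  by apply: (@swap_rank_inj a b); move: h; rewrite hk => /addnI.
- have hd : digit (L - k.+1) x = digit (L - k.+1) y by rewrite /digit h.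
  rewrite /= hd; congr (_ * _ + _)%N; apply/IH; first exact: ltnW.
  by rewrite eL /= h.
Qed.

Definition key (x : V) : nat := top_digits L x.

Lemma key_inj : injective key.
Proof. by move=> x y /(top_digits_eq x y (leqnn L)); rewrite subnn. Qed.

Variable tau : R.
Hypotheses (tau_gt0 : 0 < tau).

(* [swap_rank] puts the children of index [a] and [b] of every cluster next to
   each other, so that this relation holds between consecutive intervals of
   [key]. *)
Definition adjacent_far (i : nat) (x y : V) : bool :=
  [&& (i < L)%N, cluster t i.+1 x == cluster t i.+1 y,
      child_index t i (cluster t i x) == a, child_index t i (cluster t i y) == b
    & tau * scale i <= M (cluster t i x) (cluster t i y)].

Lemma adjacent_far_neq i x y : adjacent_far i x y ->
  cluster t i x <> cluster t i y.
Proof.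
case/and5P => _ _ _ _ h e; move: h; rewrite e dist_xx leNgt.
by rewrite mulr_gt0 ?scale_gt0.
Qed.

Lemma adjacent_far_index i x y : adjacent_far i x y -> a <> b.
Proof.
move=> h ab; apply: (adjacent_far_neq h).
case/and5P: h => _ /eqP e /eqP ha /eqP hb _.
by apply: child_index_inj; rewrite // ha hb.
Qed.

(** Below a common prefix, [swap_rank] gives the two clusters the last digits 0 and 1. *)
Lemma adjacent_far_digits i x y : adjacent_far i x y ->
  top_digits (L - i) y = (top_digits (L - i) x).+1.
Proof.
move=> h; have ab := adjacent_far_index h.
case/and5P: h => iL /eqP e /eqP ha /eqP hb _.
have -> : (L - i = (L - i.+1).+1)%N by lia.
have eL : (L - (L - i.+1) = i.+1)%N by lia.
have h : top_digits (L - i.+1) x = top_digits (L - i.+1) y.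
  by apply/top_digits_eq; [lia | rewrite eL].
rewrite /= h -addnS; congr addn.
have -> : (L - (L - i.+1).+1 = i)%N by lia.
rewrite /digit ha hb /swap_rank !eqxx.
by case: eqP => // /esym.
Qed.

Lemma adjacent_far_lt i x y : adjacent_far i x y -> (key x < key y)%N.
Proof.
move=> h; rewrite ltnNge; apply/negP => /(top_digits_mono (leq_subr i L)).
by rewrite (adjacent_far_digits h); lia.
Qed.

(** The level is the last one at which the clusters of [x] and [y] differ, since clusters once
    merged stay merged. *)
Lemma adjacent_far_uniq i j x y :
  adjacent_far i x y -> adjacent_far j x y -> i = j.
Proof.
suff lt i' j' : adjacent_far i' x y -> adjacent_far j' x y -> (j' <= i')%N.
  by move=> hi hj; apply/eqP; rewrite eqn_leq !lt.
move=> hi /adjacent_far_neq hj; rewrite leqNgt; apply/negP => ij.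
by apply: hj; apply: cluster_up ij _; case/and5P: hi => _ /eqP.
Qed.

Lemma adjacent_far_eql i x z y : cluster t i x = cluster t i z ->
  adjacent_far i x y -> adjacent_far i z y.
Proof. by rewrite /adjacent_far /= => ->. Qed.

Lemma adjacent_far_eqr i x z y : cluster t i x = cluster t i z ->
  adjacent_far i y x -> adjacent_far i y z.
Proof. by rewrite /adjacent_far /= => ->. Qed.

(** The prefixes of [x] and [y] are consecutive integers, so the prefix of [z] equals one of
    them. *)
Lemma adjacent_far_between i x y z : adjacent_far i x y ->
  (key x <= key z)%N -> (key z <= key y)%N ->
  adjacent_far i z y \/ adjacent_far i x z.
Proof.
move=> h /(top_digits_mono (leq_subr i L)) xz /(top_digits_mono (leq_subr i L)).
rewrite (adjacent_far_digits h) => zy.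
have iL : (i < L)%N by case/and5P: h.
have eL : (L - (L - i) = i)%N by lia.
have [e|e] : top_digits (L - i) x = top_digits (L - i) z \/
  top_digits (L - i) y = top_digits (L - i) z.
- by rewrite (adjacent_far_digits h); lia.
- left; apply: adjacent_far_eql h; move/top_digits_eq: e.
  by rewrite eL; apply; lia.
- right; apply: adjacent_far_eqr h; move/top_digits_eq: e.
  by rewrite eL; apply; lia.
Qed.

Lemma adjacent_far_sourceE i x y x' y' : adjacent_far i x y ->
  adjacent_far i x' y' -> cluster t i.+1 x = cluster t i.+1 x' ->
  cluster t i x = cluster t i x'.
Proof.
move=> /and5P[_ _ /eqP h _ _] /and5P[_ _ /eqP h' _ _] e.
by apply: child_index_inj; rewrite // h h'.
Qed.

Lemma adjacent_far_targetE i x y x' y' : adjacent_far i x y ->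
  adjacent_far i x' y' -> cluster t i.+1 y = cluster t i.+1 y' ->
  cluster t i y = cluster t i y'.
Proof.
move=> /and5P[_ _ _ /eqP h _] /and5P[_ _ _ /eqP h' _] e.
by apply: child_index_inj; rewrite // h h'.
Qed.

Lemma adjacent_far_parent i x y : adjacent_far i x y ->
  cluster t i.+1 x = cluster t i.+1 y.
Proof. by case/and5P => _ /eqP. Qed.

(** The parent cluster and the index [a] determine the source cluster, so [x] and [x'] share it. *)
Lemma adjacent_far_rect i x y x' y' : adjacent_far i x y ->
  adjacent_far i x y' -> adjacent_far i x' y' -> adjacent_far i x' y.
Proof.
move=> h h' h''; apply: adjacent_far_eql h.
apply: (adjacent_far_sourceE h' h'').
by rewrite (adjacent_far_parent h') -(adjacent_far_parent h'').
Qed.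

Lemma dist_cluster i x y :
  `|M x y - M (cluster t i x) (cluster t i y)| <= 8 * scale i.
Proof.
have hx := cluster_radius t i x; have hy := cluster_radius t i y.
move: (cluster t i x) (cluster t i y) hx hy => p q.
have := dist_triangle M x p y; have := dist_triangle M p q y.
have := dist_triangle M p x q; have := dist_triangle M x y q.
rewrite (dist_sym M p x) (dist_sym M q y) ler_norml => *.
by apply/andP; split; lra.
Qed.

(** The points [x] and [z] share a level-[i] cluster, hence are within [8 * scale i], while [M x y]
    is at least [(tau - 8) * scale i]. *)
Lemma adjacent_far_source e i x y z : 8 <= e * (tau - 8) -> 0 <= e ->
  adjacent_far i x y -> adjacent_far i z y -> M x z <= e * M x y.
Proof.
move=> he e0 hx hz.
have exz : cluster t i x = cluster t i z.
  apply: (adjacent_far_sourceE hx hz).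
  by rewrite (adjacent_far_parent hx) (adjacent_far_parent hz).
have := dist_cluster i x z; rewrite exz dist_xx ler_norml => /andP[_ xz].
have := dist_cluster i x y; rewrite ler_norml => /andP[xy _].
have /and5P[_ _ _ _ far] := hx.
have s0 := scale_gt0 i.
have : (tau - 8) * scale i <= M x y by lra.
move=> /(ler_wpM2l e0); rewrite mulrA.
have : 8 * scale i <= e * (tau - 8) * scale i by rewrite ler_wpM2r // ltW.
lra.
Qed.

Lemma adjacent_far_target e i x y z : 8 <= e * (tau - 8) -> 0 <= e ->
  adjacent_far i x y -> adjacent_far i x z -> M z y <= e * M x y.
Proof.
move=> he e0 hy hz.
have exz : cluster t i z = cluster t i y.
  apply: (adjacent_far_targetE hz hy).
  by rewrite -(adjacent_far_parent hy) -(adjacent_far_parent hz).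
have := dist_cluster i z y; rewrite exz dist_xx ler_norml => /andP[_ xz].
have := dist_cluster i x y; rewrite ler_norml => /andP[xy _].
have /and5P[_ _ _ _ far] := hy.
have s0 := scale_gt0 i.
have : (tau - 8) * scale i <= M x y by lra.
move=> /(ler_wpM2l e0); rewrite mulrA.
have : 8 * scale i <= e * (tau - 8) * scale i by rewrite ler_wpM2r // ltW.
lra.
Qed.

End Hierarchy.

(** * Orders covering all pairs *)

(* For each level [i], [adj i] is a disjoint union of products [X * Y] where [X]
   and [Y] are consecutive intervals of the order given by [key]. *)
Record interval_adjacency (V : finType) (key : V -> nat)
    (adj : nat -> rel V) : Prop := IntervalAdjacency {
  adj_lt : forall i x y, adj i x y -> (key x < key y)%N;
  adj_uniq : forall i j x y, adj i x y -> adj j x y -> i = j;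
  adj_between : forall i x y z, adj i x y -> (key x <= key z)%N ->
    (key z <= key y)%N -> adj i z y \/ adj i x z;
  adj_rect : forall i x y x' y', adj i x y -> adj i x y' -> adj i x' y' ->
    adj i x' y }.

Record adjacency_cover (R : realType) (V : finType) (M : finite_metric R V)
    (e : R) (m : nat) (key : 'I_m -> V -> nat) (adj : 'I_m -> nat -> rel V)
    : Prop := AdjacencyCover {
  cover_key_inj : forall j, injective (key j);
  cover_adj : forall j, interval_adjacency (key j) (adj j);
  cover_source : forall j i x y z, adj j i x y -> adj j i z y ->
    M x z <= e * M x y;
  cover_target : forall j i x y z, adj j i x y -> adj j i x z ->
    M z y <= e * M x y;
  cover_ex : forall x y, x != y -> exists j i, adj j i x y }.

Lemma ex_pow_ge (R : realType) (r D x : R) : 0 < r -> 2 <= D ->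
  exists n, x <= r * D ^+ n.
Proof.
move=> r0 D2; have [n hn] : exists n, x / r < 2 ^+ n.
  by exists (Num.bound (x / r)); exact: upper_nthrootP.
exists n; rewrite -ler_pdivrMl // mulrC (le_trans (ltW hn)) //.
by rewrite lerXn2r // nnegrE; lra.
Qed.

Section FiniteMetric.
Variables (R : realType) (V : finType) (M : finite_metric R V).

Lemma ex_min_dist : exists2 r, 0 < r & forall x y, x != y -> r < M x y.
Proof.
pose S := \sum_(p : V * V) (M p.1 p.2)^-1.
have S0 : 0 <= S by apply: sumr_ge0 => p _; rewrite invr_ge0 dist_ge0.
have S1 : 0 < 1 + S by lra.
(* Each inverse distance is one term of [S]; the diagonal terms are [0^-1 = 0]. *)
exists (1 + S)^-1; first by rewrite invr_gt0.
move=> x y xy; have M0 := dist_gt0 M xy.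
rewrite invf_plt ?posrE //.
have : (M x y)^-1 <= S.
  rewrite /S (bigD1 (x, y)) //= lerDl; apply: sumr_ge0 => p _.
  by rewrite invr_ge0 dist_ge0.
by lra.
Qed.

Lemma ex_max_dist : exists r, forall x y, M x y <= r.
Proof.
exists (\sum_(p : V * V) M p.1 p.2) => x y.
rewrite (bigD1 (x, y)) //= lerDl; apply: sumr_ge0 => p _; exact: dist_ge0.
Qed.

Lemma separatedS (r : R) (S S' : {set V}) : S' \subset S ->
  separated M r S -> separated M r S'.
Proof.
move=> /subsetP sS /separatedP h; apply/separatedP => a b aS bS.
by apply: h; exact: sS.
Qed.

(** The exponent 4 comes from packing: [2 * (6 * r) <= r * 2 ^ 4]. *)
Lemma ex_colored_nets k : half_coverable M k ->
  exists (net : R -> {set V}) (color : R -> V -> 'I_(k ^ 4).+1),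
  [/\ forall r, 0 <= r -> separated M r (net r),
      forall r x, 0 <= r -> exists2 c, c \in net r & M x c <= r
    & forall r a b, 0 <= r -> a \in net r -> b \in net r -> a != b ->
        M a b <= 6 * r -> color r a != color r b].
Proof.
move=> hk.
have /choice[net hnet] (r : R) : exists N : {set V}, 0 <= r ->
    separated M r N /\ forall x, exists2 c, c \in N & M x c <= r.
  have [r0|r0] := leP 0 r; last by exists set0 => h; lra.
  by have [N sN hN] := ex_net M r0; exists N.
have /choice[color hcolor] (r : R) : exists col : V -> 'I_(k ^ 4).+1,
    forall a b, 0 <= r -> a \in net r -> b \in net r -> a != b ->
    M a b <= 6 * r -> col a != col b.
  have [r0|r0] := ltP 0 r; last first.
    exists (fun=> ord0) => a b _ _ _ /(dist_gt0 M); lra.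
  have [||col hcol] :=
    @ex_coloring V (fun a b => M a b <= 6 * r) (net r) (k ^ 4).
  - by move=> a b; rewrite dist_sym.
  - move=> a aN; apply: (card_separated (x := a) (r := 6 * r) (s := r) hk).
    + by lra.
    + by rewrite (_ : 2 ^+ 4 = 16); [lra | rewrite -natrX].
    + apply: separatedS (proj1 (hnet r (ltW r0))).
      by apply/subsetP => b; rewrite inE => /andP[].
    + by apply/subsetP => b; rewrite !inE => /andP[].
  - by exists col => a b _ aN bN ab h; apply: hcol.
exists net, color; split=> //.
- by move=> r /hnet[].
- by move=> r x /hnet[_]; apply.
Qed.

End FiniteMetric.

Lemma ex_adjacency_cover (R : realType) (e : R) (k : nat) : 0 < e ->
  exists m, forall (V : finType) (M : finite_metric R V), half_coverable M k ->
  exists (key : 'I_m -> V -> nat) (adj : 'I_m -> nat -> rel V),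
    adjacency_cover M e key adj.
Proof.
move=> e0; pose tau := 8 / e + 8; pose D := tau + 8; pose Q := D ^+ 2.
have tau8 : 8 < tau by have : 0 < 8 / e; [rewrite divr_gt0 | rewrite /tau; lra].
have htau : 8 <= e * (tau - 8).
  by rewrite /tau addrK mulrC divfK ?lt0r_neq0.
have D16 : 16 < D by rewrite /D; lra.
have Q4 : 4 <= Q by rewrite /Q expr2; nra.
(* Siblings are [scale i]-separated in a ball of radius [3 * Q * scale i], so [k ^ h] bounds their
   number. *)
have [h hh] : exists h, 6 * Q <= 1 * 2 ^+ h :> R by apply: ex_pow_ge; lra.
pose K := (k ^ h)%N.
(* One order per shift, color and pair of child indices; the count depends on [e] and [k] only. *)
pose J := (bool * 'I_(k ^ 4).+1 * 'I_K * 'I_K)%type.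
exists #|{: J}| => V M hk.
have [net [color [nsep ncov csep]]] := ex_colored_nets hk.
have [r1 r1_gt0 hr1] := ex_min_dist M.
have [r2 hr2] := ex_max_dist M.
(* After the division both bases, [r0] and [D * r0], stay below all positive distances. *)
pose r0 := r1 / D.
have r0_gt0 : 0 < r0 by rewrite divr_gt0 //; lra.
have r0D : D * r0 = r1 by rewrite /r0 mulrC divfK //; lra.
have [|L hL] := @ex_pow_ge R r0 Q r2 r0_gt0; first by lra.
pose base (s : bool) := if s then D * r0 else r0.
have base0 s : 0 < base s by rewrite /base; case: s => //; rewrite r0D.
have base_small s x y : x != y -> base s < M x y.
  move=> /hr1 h1; apply: le_lt_trans h1.
  rewrite /base; case: s; first by rewrite r0D.
  by rewrite -r0D ler_peMl //; lra.
have L_large s x y : M x y <= scale (base s) Q L.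
  apply: le_trans (hr2 x y) _; apply: le_trans hL _.
  rewrite /scale ler_wpM2r ?exprn_ge0 //; first by lra.
  by rewrite /base; case: s => //; rewrite ler_peMl //; lra.
have sib s t i q : (#|siblings M net color (base s) Q t i q| <= K)%N.
  have s0 := scale_gt0 (base0 s) Q4 i; have s1 := scale_gt0 (base0 s) Q4 i.+1.
  apply: (@card_separated _ _ M k h
    (parent M net color t (scale (base s) Q i.+1) q)
    (3 * scale (base s) Q i.+1) (scale (base s) Q i) _ hk).
  - by lra.
  - rewrite scaleS mul1r in hh *.
    by have := ler_wpM2l (ltW s0) hh; lra.
  - apply: separatedS (nsep _ (ltW s0)).
    by apply/subsetP => x; rewrite inE => /andP[].
  - apply/subsetP => x; rewrite !inE => /andP[_ /eqP <-]; rewrite dist_sym.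
    by have [] := parentP color ncov t x (ltW s1).
pose key (j : 'I_#|{: J}|) x := let: (s, t, a, b) := enum_val j in
  key M net color (base s) Q L K t a b x.
pose adj (j : 'I_#|{: J}|) i x y := let: (s, t, a, b) := enum_val j in
  adjacent_far M net color (base s) Q L t a b tau i x y.
have tau0 : 0 < tau by lra.
exists key, adj; split.
- move=> j; rewrite /key; case: (enum_val j) => [[[s t] a] b].
  exact: (key_inj nsep ncov (base0 s) Q4 (base_small s) (L_large s) (sib s)).
- move=> j; rewrite /key /adj; case: (enum_val j) => [[[s t] a] b]; split.
  + exact: (adjacent_far_lt nsep ncov (base0 s) Q4 (base_small s)
      (L_large s) (sib s) tau0).
  + exact: (adjacent_far_uniq (base0 s) Q4 tau0).
  + exact: (adjacent_far_between nsep ncov (base0 s) Q4 (base_small s)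
      (L_large s) (sib s) tau0).
  + exact: (adjacent_far_rect ncov (base0 s) Q4 (base_small s)).
- move=> j i x y z; rewrite /adj; case: (enum_val j) => [[[s t] a] b].
  exact: (adjacent_far_source ncov (base0 s) Q4 (base_small s) htau (ltW e0)).
- move=> j i x y z; rewrite /adj; case: (enum_val j) => [[[s t] a] b].
  exact: (adjacent_far_target ncov (base0 s) Q4 (base_small s) htau (ltW e0)).
move=> x y xy; have M0 := dist_gt0 M xy.
have [|n] := @ex_pow_ge R r0 D (M x y) r0_gt0; first by lra.
move=> hn; have {hn} ex : exists n, M x y <= r0 * D ^+ n.+2.
  exists n; apply: le_trans hn _; rewrite ler_wpM2l ?(ltW r0_gt0) //.
  by rewrite ler_weXn2l //; [lra | lia].
(* Minimality of [l] places [M x y] between [r0 * D ^+ l.+1] and [r0 * D ^+ l.+2]; for [l = 0] the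
   lower bound is the choice of [r0]. *)
case: (ex_minnP ex) => l hl lmin.
have hl' : r0 * D ^+ l.+1 <= M x y.
  case: l hl lmin => [|l] _ lmin.
    by rewrite expr1 mulrC r0D ltW // hr1.
  rewrite leNgt; apply/negP => /ltW /lmin; lia.
(* The parity of [l] selects the shift for which [r0 * D ^+ l] is a scale; the next scale is then at
   least [M x y], as [cluster_padded] requires. *)
pose s := odd l; pose i := l./2.
have el : scale (base s) Q i = r0 * D ^+ l.
  rewrite /scale /Q -exprM -[in RHS](odd_double_half l) exprD.
  rewrite -muln2 (mulnC _ 2).
  rewrite [RHS]mulrA; congr (_ * _); rewrite /base /s.
  by case: (odd l); rewrite ?expr0 ?expr1 ?mulr1 // mulrC.
have [t ht] := cluster_padded ncov csep (base0 s) Q4 i x.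
have hs : scale (base s) Q i.+1 = r0 * D ^+ l.+2.
  by rewrite scaleS el /Q !exprS expr0; ring.
have hxy : cluster M net color (base s) Q t i.+1 x =
    cluster M net color (base s) Q t i.+1 y.
  by apply: ht; rewrite hs.
have ci z : (child_index M net color (base s) Q t i
    (cluster M net color (base s) Q t i z) < K)%N.
  exact: (child_index_lt ncov (base0 s) Q4 (base_small s) (sib s)).
pose j : J := (s, t, Ordinal (ci x), Ordinal (ci y)).
exists (enum_rank j), i; rewrite /adj enum_rankK /=.
have s0 := scale_gt0 (base0 s) Q4 i.
have Dl : D * scale (base s) Q i <= M x y.
  by rewrite el mulrCA -exprS.
apply/and5P; split=> //; last 2 first.
- exact/eqP.
- have := dist_cluster color ncov (base0 s) Q4 t i x y.
  rewrite ler_norml => /andP[_].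
  by move: Dl; rewrite /D; lra.
- rewrite ltnNge; apply/negP => Li.
  have := L_large s x y.
  have : scale (base s) Q L <= scale (base s) Q i.
    by rewrite /scale ler_wpM2l ?(ltW (base0 s)) // ler_weXn2l //; lra.
  have : 1 * scale (base s) Q i < D * scale (base s) Q i.
    by rewrite ltr_pM2r //; lra.
  lra.
Qed.

(** * Separators on a line *)

Section KeyRank.
Variables (V : finType) (key : V -> nat).
Local Open Scope nat_scope.

(** The keys grow with the number of scales, that is with the aspect ratio; ranks keep the order and
    stay below [#|V|]. *)
Definition key_rank (x : V) : nat := #|[set y | key y < key x]|.

Lemma key_rank_lt x y : (key_rank x < key_rank y) = (key x < key y).
Proof.
have mono a b : key a <= key b -> key_rank a <= key_rank b.
  move=> ab; apply/subset_leq_card/subsetP => z; rewrite !inE => za.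
  exact: leq_trans za ab.
apply/idP/idP => [|xy].
  by rewrite ltnNge => h; rewrite ltnNge; apply: contra h; exact: mono.
apply: proper_card; apply/properP; split.
  by apply/subsetP => z; rewrite !inE => zx; exact: ltn_trans zx xy.
by exists x; rewrite !inE // ltnn.
Qed.

Lemma key_rank_le x y : (key_rank x <= key_rank y) = (key x <= key y).
Proof. by rewrite [LHS]leqNgt key_rank_lt -leqNgt. Qed.

Lemma key_rank_inj : injective key -> injective key_rank.
Proof.
by move=> ki x y h; apply: ki; apply/eqP; rewrite eqn_leq -!key_rank_le h leqnn.
Qed.

Lemma key_rank_lt_card x : key_rank x < #|V|.
Proof.
rewrite -cardsT; apply: proper_card; apply/properP; split.
  exact: subsetT.
by exists x; rewrite !inE // ltnn.
Qed.

Lemma key_rank_adj adj : interval_adjacency key adj ->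
  interval_adjacency key_rank adj.
Proof.
case=> lt uniq bet rect; split=> //.
  by move=> i x y; rewrite key_rank_lt; exact: lt.
by move=> i x y z; rewrite !key_rank_le; exact: bet.
Qed.

End KeyRank.

Lemma key_rank_cover (R : realType) (V : finType) (M : finite_metric R V)
  (e : R) m (key : 'I_m -> V -> nat) adj : adjacency_cover M e key adj ->
  adjacency_cover M e (fun j => key_rank (key j)) adj.
Proof.
case=> ki ka ks kt kex; split=> // j; first exact: key_rank_inj.
exact: key_rank_adj.
Qed.

(** * Encoding the adjacency by bounds and bits *)

Section AdjacencyLabels.
Variables (V : finType) (key : V -> nat) (adj : nat -> rel V).
Hypothesis adjP : interval_adjacency key adj.
Local Open Scope nat_scope.

Definition right_bound (u s : V) : nat :=
  \max_(v | `[< exists i, adj i u s /\ adj i u v >]) (key v).+1.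

(** A minimum of keys written through a maximum, so that the empty case yields [#|V|], which exceeds
    every key. *)
Definition left_bound (s v : V) : nat :=
  #|V| - \max_(u | `[< exists i, adj i s v /\ adj i u v >]) (#|V| - key u).

Definition source_bit (u s1 s2 : V) : bool :=
  `[< exists i, adj i s1 s2 /\ adj i u s2 >].

Definition target_bit (s1 s2 v : V) : bool :=
  `[< exists i, adj i s1 s2 /\ adj i s1 v >].

Hypothesis key_lt_card : forall x, key x < #|V|.

(** Some good [v'] is not before [v]. By [adj_between], [v] is on the target side, for on the source
    side [adj_rect] would put it before [s]. *)
Lemma right_boundP u s v : key s <= key v ->
  (key v < right_bound u s) <-> (exists i, adj i u s /\ adj i u v).
Proof.
move=> sv; split=> [|h]; last first.
  by rewrite /right_bound (bigD1 v) ?leq_maxl //; apply/asboolP.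
case: (pickP [pred v' | `[< exists i, adj i u s /\ adj i u v' >] &
    key v < (key v').+1]) => [v' /andP[/asboolP[i [us uv']] vv']|h] lt.
  exists i; split=> //.
  have uv : key u <= key v.
    by apply: leq_trans sv; rewrite ltnW // (adj_lt adjP us).
  case: (adj_between adjP uv' uv vv') => // vv''.
  have := adj_rect adjP us uv' vv''.
  by move=> /(adj_lt adjP); rewrite ltnNge sv.
move: lt; rewrite ltnNge => /negP[]; apply/bigmax_leqP => v' hv'.
by move: (h v'); rewrite /= hv' /=; lia.
Qed.

Lemma left_boundP u s v : key u <= key s ->
  (left_bound s v <= key u) <-> (exists i, adj i s v /\ adj i u v).
Proof.
move=> us; split=> [|h]; last first.
  rewrite /left_bound (bigD1 u) /=; last by apply/asboolP.
  by have := key_lt_card u; lia.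
case: (pickP [pred u' | `[< exists i, adj i s v /\ adj i u' v >] &
    key u' <= key u]) => [u' /andP[/asboolP[i [sv uv']] uu']|h] lt.
  exists i; split=> //.
  have uv : key u <= key v.
    by apply: leq_trans us _; rewrite ltnW // (adj_lt adjP sv).
  case: (adj_between adjP uv' uu' uv) => // uu''.
  have := adj_rect adjP uu'' uv' sv.
  by move=> /(adj_lt adjP); rewrite ltnNge us.
move: lt; rewrite /left_bound leq_subLR => lt.
have : \max_(u' | `[< exists i, adj i s v /\ adj i u' v >]) (#|V| - key u')
    <= #|V| - (key u).+1.
  by apply/bigmax_leqP => u' hu'; move: (h u'); rewrite /= hu' /=; lia.
by have := key_lt_card u; lia.
Qed.

(** The change from source to target interval happens before [s1], after [s2] or between them, in
    the order of the disjuncts. In the last case the two bits speak of the same level by [adj_uniq]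
    on [s1] and [s2]. *)
Lemma adj_labelP u s1 s2 v : key u <= key s1 -> key s1 <= key s2 ->
  key s2 <= key v -> (exists i, adj i u v) <->
  [|| key v < right_bound u s1, left_bound s2 v <= key u
    | source_bit u s1 s2 && target_bit s1 s2 v].
Proof.
move=> us ss sv; split=> [[i uv]|].
  apply/or3P.
  have [s1v|us1] : adj i s1 v \/ adj i u s1.
    by apply: (adj_between adjP uv) => //; exact: leq_trans sv.
  - have [s2v|us2] : adj i s2 v \/ adj i u s2.
    + by apply: (adj_between adjP uv) => //; exact: leq_trans us ss.
    + by constructor 2; apply/(left_boundP _ (leq_trans us ss)); exists i.
    + have s12 := adj_rect adjP us2 uv s1v.
      by constructor 3; apply/andP; split; apply/asboolP; exists i.
  - by constructor 1; apply/(right_boundP _ (leq_trans ss sv)); exists i.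
case/or3P.
- by move=> /(right_boundP _ (leq_trans ss sv))[i [_ h]]; exists i.
- by move=> /(left_boundP _ (leq_trans us ss))[i [_ h]]; exists i.
- move=> /andP[/asboolP[i [h us2]] /asboolP[i' [h' s1v]]].
  rewrite -(adj_uniq adjP h h') in s1v.
  by exists i; exact: (adj_rect adjP s1v h us2).
Qed.

End AdjacencyLabels.

(** Each separator is within [e * M u v] of [u] or of [v], and [s2] cannot be on the side of [u]
    once [s1] is on that of [v]. In each of the three cases the detours add up to at most
    [4 * e * M u v]. *)
Lemma adjacency_detour (R : realType) (V : finType) (M : finite_metric R V)
  (e : R) m (key : 'I_m -> V -> nat) adj j i u s1 s2 v :
  0 <= e -> adjacency_cover M e key adj -> adj j i u v ->
  (key j u <= key j s1)%N -> (key j s1 <= key j s2)%N ->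
  (key j s2 <= key j v)%N ->
  M u s1 + (M s1 s2 + M s2 v) <= (1 + 4 * e) * M u v.
Proof.
move=> e0 cov uv us ss sv; have adjP := cover_adj cov j.
have d0 : 0 <= e * M u v by rewrite mulr_ge0 ?dist_ge0.
have -> : (1 + 4 * e) * M u v = M u v + 4 * (e * M u v) by ring.
have src z (h : adj j i z v) : M u z <= e * M u v := cover_source cov uv h.
have tgt z (h : adj j i u z) : M z v <= e * M u v := cover_target cov uv h.
have [/src h1|us1] : adj j i s1 v \/ adj j i u s1.
  by apply: (adj_between adjP uv) => //; exact: leq_trans sv.
  have := dist_triangle M s1 u s2; rewrite (dist_sym M s1 u).
  have [/src h2|/tgt h2] : adj j i s2 v \/ adj j i u s2.
  - by apply: (adj_between adjP uv) => //; exact: leq_trans us ss.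
  - by have := dist_triangle M s2 u v; rewrite (dist_sym M s2 u); lra.
  - by have := dist_triangle M u v s2; rewrite (dist_sym M v s2); lra.
have us2 : adj j i u s2.
  have [s2v|//] : adj j i s2 v \/ adj j i u s2.
    by apply: (adj_between adjP uv) => //; exact: leq_trans us ss.
  by have := adj_lt adjP (adj_rect adjP us1 uv s2v); rewrite ltnNge ss.
move: us1 us2 => /tgt h1 /tgt h2.
have := dist_triangle M s1 v s2; have := dist_triangle M u v s1.
by rewrite (dist_sym M v s1) (dist_sym M v s2); lra.
Qed.

(** * Separators in base [k] *)

Section Digits.
Local Open Scope nat_scope.
Variable k : nat.
Hypothesis k_gt1 : 1 < k.

Definition splits_at (p q e : nat) : bool :=
  [&& p < q, p %/ k ^ e.+1 == q %/ k ^ e.+1 & p %/ k ^ e != q %/ k ^ e].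

Lemma ex_splits_at D p q : p < q -> q < k ^ D ->
  exists2 e, e < D & splits_at p q e.
Proof.
move=> pq qD.
have ex : exists e, p %/ k ^ e == q %/ k ^ e.
  by exists D; rewrite !divn_small // (ltn_trans pq).
case: (ex_minnP ex) => -[|e] he emin.
  by move: he; rewrite expn0 !divn1; lia.
exists e; last first.
  rewrite /splits_at pq he /=; apply/negP => /emin; lia.
have : e.+1 <= D by apply: emin; rewrite !divn_small // (ltn_trans pq).
by [].
Qed.

Definition first_sep (p e : nat) : nat := (p %/ k ^ e).+1 * k ^ e.
Definition last_sep (q e : nat) : nat := q %/ k ^ e * k ^ e.
(** The multiples of [k ^ e] in the block of length [k ^ e.+1] around [p], indexed by their digit
    [b]. *)
Definition sibling_sep (p e b : nat) : nat := (p %/ k ^ e.+1 * k + b) * k ^ e.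

Lemma expk_gt0 e : 0 < k ^ e.
Proof. by rewrite expn_gt0; lia. Qed.

Lemma divk_expS p e : p %/ k ^ e.+1 = p %/ k ^ e %/ k.
Proof. by rewrite expnSr divnMA. Qed.

Section Split.
Variables (p q e : nat).
Hypothesis split_pq : splits_at p q e.

Lemma split_ltn : p %/ k ^ e < q %/ k ^ e.
Proof.
case/and3P: split_pq => pq _ ne; rewrite ltn_neqAle ne.
by rewrite leq_div2r // ltnW.
Qed.

Lemma first_sep_gt : p < first_sep p e.
Proof. by rewrite /first_sep -ltn_divLR ?expk_gt0. Qed.

Lemma first_last_sep : first_sep p e <= last_sep q e.
Proof. by rewrite leq_mul2r split_ltn orbT. Qed.

Lemma last_sep_le : last_sep q e <= q.
Proof. exact: leq_trunc_div. Qed.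

Lemma first_sep_digits : (p %/ k ^ e).+1 %/ k = q %/ k ^ e.+1.
Proof.
apply/eqP; rewrite eqn_leq; apply/andP; split.
  by rewrite divk_expS leq_div2r // split_ltn.
case/and3P: split_pq => _ /eqP <- _.
by rewrite divk_expS leq_div2r.
Qed.

Lemma first_sep_div : first_sep p e %/ k ^ e.+1 = q %/ k ^ e.+1.
Proof. by rewrite divk_expS mulnK ?expk_gt0 // first_sep_digits. Qed.

Lemma sibling_first_sep :
  sibling_sep q e ((p %/ k ^ e).+1 %% k) = first_sep p e.
Proof. by rewrite /sibling_sep -first_sep_digits -divn_eq. Qed.

Lemma sibling_last_sep : sibling_sep p e (q %/ k ^ e %% k) = last_sep q e.
Proof.
case/and3P: split_pq => _ /eqP h _.
by rewrite /sibling_sep h divk_expS -divn_eq.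
Qed.

(** As [q] lies further on in the same block, incrementing the digit of [p] causes no carry. This
    lets a separator recover its level from its own rank. *)
Lemma first_sep_mod : (p %/ k ^ e).+1 %% k != 0.
Proof.
case/and3P: split_pq => _ /eqP h _; have := first_sep_digits.
rewrite -h divk_expS => h'.
have := divn_eq (p %/ k ^ e).+1 k; have := divn_eq (p %/ k ^ e) k.
have := ltn_pmod (p %/ k ^ e) (ltnW k_gt1).
by rewrite h'; case: ((p %/ k ^ e).+1 %% k) => //; lia.
Qed.

End Split.

Definition sep_level (D p : nat) : nat :=
  find (fun e => p %/ k ^ e %% k != 0) (iota 0 D).

Lemma sep_level_first_sep D p q e : e < D -> splits_at p q e ->
  sep_level D (first_sep p e) = e.
Proof.
move=> eD h; rewrite /sep_level.
have -> : D = e + (D - e).-1.+1 by lia.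
rewrite iotaD find_cat size_iota /= add0n.
have -> : has (fun i => first_sep p e %/ k ^ i %% k != 0) (iota 0 e) = false.
  apply/hasP => -[i]; rewrite mem_iota /= add0n => ie /negP[].
  rewrite /first_sep -{2}(subnK (ltnW ie)) expnD mulnA mulnK ?expk_gt0 //.
  rewrite (_ : e - i = (e - i.+1).+1); last by lia.
  by rewrite expnSr mulnA modnMl.
by rewrite /first_sep mulnK ?expk_gt0 // (first_sep_mod h) addn0.
Qed.

End Digits.

(** * Tables, labels and forwarding *)

(* The data that a vertex keeps about a separator of one order at one level:
   name of the separator, port (from the vertex to the separator in a table, in
   the opposite direction in a label), bound of [right_bound] or [left_bound],
   and the bits [source_bit] or [target_bit]. *)
Definition sep_data : Type := nat * nat * nat * seq bool.

(* Rank of the vertex, ports to its sibling separators, data for each level. *)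
Definition order_data : Type := nat * seq nat * seq sep_data.

(* Radix, number of levels, name, data for each order. *)
Definition vertex_data : Type := nat * nat * nat * seq order_data.

Definition code_sep : sep_data -> seq bool :=
  code_pair (code_pair (code_pair code_nat code_nat) code_nat)
    (code_seq code_bool).

Definition code_order : order_data -> seq bool :=
  code_pair (code_pair code_nat (code_seq code_nat)) (code_seq code_sep).

Definition code_vertex : vertex_data -> seq bool :=
  code_pair (code_pair (code_pair code_nat code_nat) code_nat)
    (code_seq code_order).

Lemma prefix_code_vertex : prefix_code code_vertex.
Proof.
have n := prefix_code_nat.
do ?[apply: prefix_code_pair | apply: prefix_code_seq] => //.
exact: prefix_code_bool.
Qed.

Definition radix (t : vertex_data) := t.1.1.1.
Definition depth (t : vertex_data) := t.1.1.2.
Definition name (t : vertex_data) := t.1.2.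
Definition rank (t : vertex_data) j := (nth (0%N, [::], [::]) t.2 j).1.1.
Definition sibling_ports (t : vertex_data) j :=
  (nth (0%N, [::], [::]) t.2 j).1.2.
Definition sep (t : vertex_data) j e : sep_data :=
  nth (0%N, 0%N, 0%N, [::]) (nth (0%N, [::], [::]) t.2 j).2 e.
Definition sep_name (s : sep_data) := s.1.1.1.
Definition sep_port (s : sep_data) := s.1.1.2.
Definition sep_bound (s : sep_data) := s.1.2.
Definition sep_bits (s : sep_data) := s.2.

Section Rules.
Local Open Scope nat_scope.

(** The test of [adj_labelP] on stored data: the digit of [q] tells the source which sibling is
    [s2], and the incremented digit of [p] tells which one is [s1]. *)
Definition suitable (t l : vertex_data) (je : nat * nat) : bool :=
  let: (j, e) := je in let k := radix t in
  let p := rank t j in let q := rank l j in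
  splits_at k p q e &&
  [|| q < sep_bound (sep t j e), sep_bound (sep l j e) <= p
    | nth false (sep_bits (sep t j e)) (q %/ k ^ e %% k) &&
      nth false (sep_bits (sep l j e)) ((p %/ k ^ e).+1 %% k)].

Definition choose_split (m : nat) (t l : vertex_data) : nat * nat :=
  let s := [seq (j, e) | j <- iota 0 m, e <- iota 0 (depth t)] in
  nth (0, 0) s (find (suitable t l) s).

(** Layout: destination; name of [s2] and its port to [v]; name of [s1] and the port of [u] to it;
    order and digit by which [s1] finds its port to [s2]. *)
Definition aux_data (m : nat) (t l : vertex_data) : seq nat :=
  if name t == name l then [:: name l] else
  let: (j, e) := choose_split m t l in let k := radix t in
  [:: name l; sep_name (sep l j e); sep_port (sep l j e);
      sep_name (sep t j e); sep_port (sep t j e); j; rank l j %/ k ^ e %% k].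

(** The tests run backwards from the destination, so coinciding separators shorten the route. *)
Definition next_port (t : vertex_data) (a : seq nat) : option nat :=
  if name t == nth 0 a 0 then None
  else if name t == nth 0 a 1 then Some (nth 0 a 2)
  else if name t == nth 0 a 3
    then Some (nth 0 (sibling_ports t (nth 0 a 5)) (nth 0 a 6))
  else Some (nth 0 a 4).

Definition read_vertex : seq bool -> vertex_data :=
  decode (0, 0, 0, [::]) code_vertex.

Definition read_aux : seq bool -> seq nat := decode [::] (code_seq code_nat).

Definition rules (m : nat) : routing_rules := RoutingRules
  (fun t l => code_seq code_nat (aux_data m (read_vertex t) (read_vertex l)))
  (fun t h => next_port (read_vertex t) (read_aux h.2)).

Lemma choose_splitP m t l j e : j < m -> e < depth t -> suitable t l (j, e) ->
  [/\ (choose_split m t l).1 < m, (choose_split m t l).2 < depth t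
    & suitable t l (choose_split m t l)].
Proof.
move=> jm et h; rewrite /choose_split.
set s := [seq _ | _ <- _, _ <- _].
have hs : has (suitable t l) s.
  by apply/hasP; exists (j, e) => //; apply: allpairs_f; rewrite mem_iota.
have : nth (0, 0) s (find (suitable t l) s) \in s by rewrite mem_nth -?has_find.
have := nth_find (0, 0) hs; move: (nth _ _ _) => je hje /allpairsP.
case=> -[j' e'] /= [hj he E]; move: hj he hje; rewrite E !mem_iota.
by split.
Qed.

End Rules.

Definition complete_overlay (V : finType) : overlay V.
Proof.
exists (fun x y => x != y) => [x y|x]; first by rewrite eq_sym.
by rewrite eqxx.
Defined.

(** Forwarding is deterministic and ports are injective. Hop count and stretch thus need checking on
    one route per pair only. *)
Lemma routed_path_uniq (V : finType) (A : routing_rules) (E : overlay V)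
  (P : port_numbering E) (S : assignment V) u v s s' :
  routed_path A P S u v s -> routed_path A P S u v s' -> s = s'.
Proof.
rewrite /routed_path; move: (packet_header _ _ _ _) => h.
elim: s s' u => [|w s IH] [|w' s'] u //=.
- by move=> /andP[/eqP <- /eqP h1] /and3P[/andP[/andP[_ /eqP h2] _] _ _];
    rewrite h2 in h1.
- by move=> /and3P[/andP[/andP[_ /eqP h2] _] _ _] /andP[/eqP <- /eqP h1];
    rewrite h2 in h1.
- move=> /and3P[/andP[/andP[uw /eqP hw] ps] ls fs].
  move=> /and3P[/andP[/andP[uw' /eqP hw'] ps'] ls' fs'].
  have ww' : w = w' by move: hw'; rewrite hw => -[/(port_inj uw uw')].
  by subst w'; congr cons; apply: (IH _ w); exact/and3P.
Qed.

(** * The scheme and its routes *)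

Section Scheme.
Variables (R : realType) (V : finType) (M : finite_metric R V).
Variables (e : R) (m : nat).
Variables (key : 'I_m -> V -> nat) (adj : 'I_m -> nat -> rel V).
Hypotheses (e_ge0 : 0 <= e) (cov : adjacency_cover M e key adj).
Hypothesis key_lt_card : forall j x, (key j x < #|V|)%N.
Variables (k D : nat).
Hypotheses (k_gt1 : (1 < k)%N) (V_le : (#|V| <= k ^ D)%N).
Variable P : port_numbering (complete_overlay V).
Local Open Scope nat_scope.

Definition vertex_name (x : V) : nat := enum_rank x.

Definition at_rank (j : 'I_m) (x0 : V) (p : nat) : V :=
  odflt x0 [pick x | key j x == p].

(* Guards against the unspecified value of [P] outside of the overlay. *)
Definition port_to (x y : V) : nat := if x == y then 0 else P x y.

(** An injection of [V] into [#|V|] ranks is onto, so the default [x0] is not reached. *)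
Lemma key_at_rank j x0 p : p < #|V| -> key j (at_rank j x0 p) = p.
Proof.
move=> pV; pose f x := Ordinal (key_lt_card j x).
have f_inj : injective f.
  by move=> x y [/(cover_key_inj cov)].
have [g _ gf] := inj_card_bij f_inj (eq_leq (card_ord _)).
have /= := congr1 val (gf (Ordinal pV)).
by rewrite /at_rank; case: pickP => [x /eqP//|/(_ (g (Ordinal pV)))/eqP].
Qed.

Lemma at_rank_key j x0 x : at_rank j x0 (key j x) = x.
Proof.
by apply: (cover_key_inj cov (j := j)); rewrite key_at_rank // key_lt_card.
Qed.

Definition source_sep (j : 'I_m) (u : V) (e : nat) : sep_data :=
  let s1 := at_rank j u (first_sep k (key j u) e) in
  (vertex_name s1, port_to u s1, right_bound (key j) (adj j) u s1,
   mkseq (fun b => source_bit (adj j) u s1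
     (at_rank j u (sibling_sep k (key j u) e b))) k).

Definition target_sep (j : 'I_m) (v : V) (e : nat) : sep_data :=
  let s2 := at_rank j v (last_sep k (key j v) e) in
  (vertex_name s2, port_to s2 v, left_bound (key j) (adj j) s2 v,
   mkseq (fun a => target_bit (adj j)
     (at_rank j v (sibling_sep k (key j v) e a)) s2 v) k).

(* One level is enough: [s] is a [first_sep] only at the level of its lowest
   nonzero digit. *)
Definition sibling_list (j : 'I_m) (s : V) : seq nat :=
  mkseq (fun b => port_to s (at_rank j s
    (sibling_sep k (key j s) (sep_level k D (key j s)) b))) k.

Definition table_data (u : V) : vertex_data :=
  (k, D, vertex_name u,
   [seq (key j u, sibling_list j u, mkseq (source_sep j u) D)
     | j <- enum 'I_m]).

Definition label_data (v : V) : vertex_data :=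
  (k, D, vertex_name v,
   [seq (key j v, [::], mkseq (target_sep j v) D) | j <- enum 'I_m]).

Definition scheme : assignment V := Assignment
  (fun u => code_vertex (table_data u)) (fun v => code_vertex (label_data v)).

Lemma nth_enum_map (T : Type) (x0 : T) (f : 'I_m -> T) (j : 'I_m) :
  nth x0 [seq f i | i <- enum 'I_m] j = f j.
Proof. by rewrite (nth_map j) ?size_enum_ord // nth_ord_enum. Qed.

Lemma rank_table j u : rank (table_data u) (val j) = key j u.
Proof. by rewrite /rank nth_enum_map. Qed.

Lemma rank_label j u : rank (label_data u) (val j) = key j u.
Proof. by rewrite /rank nth_enum_map. Qed.

Lemma sep_table j u i : i < D ->
  sep (table_data u) (val j) i = source_sep j u i.
Proof. by move=> iD; rewrite /sep nth_enum_map nth_mkseq. Qed.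

Lemma sep_label j u i : i < D ->
  sep (label_data u) (val j) i = target_sep j u i.
Proof. by move=> iD; rewrite /sep nth_enum_map nth_mkseq. Qed.

Section Pair.
Variables (u v : V) (j : 'I_m) (i : nat).
Hypotheses (iD : i < D) (split : splits_at k (key j u) (key j v) i).

Definition sep1 : V := at_rank j u (first_sep k (key j u) i).
Definition sep2 : V := at_rank j v (last_sep k (key j v) i).

Lemma key_sep2 : key j sep2 = last_sep k (key j v) i.
Proof.
rewrite /sep2 key_at_rank //.
exact: leq_ltn_trans (last_sep_le k _ _) (key_lt_card j v).
Qed.

Lemma first_sep_lt : first_sep k (key j u) i < #|V|.
Proof.
apply: leq_ltn_trans (first_last_sep split) _.
exact: leq_ltn_trans (last_sep_le k _ _) (key_lt_card j v).
Qed.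

Lemma key_sep1 : key j sep1 = first_sep k (key j u) i.
Proof. by rewrite /sep1 key_at_rank // first_sep_lt. Qed.

Lemma key_u_sep1 : key j u < key j sep1.
Proof. by rewrite key_sep1; apply: first_sep_gt. Qed.

Lemma key_sep12 : key j sep1 <= key j sep2.
Proof. by rewrite key_sep1 key_sep2; apply: first_last_sep. Qed.

Lemma key_sep2_v : key j sep2 <= key j v.
Proof. by rewrite key_sep2 last_sep_le. Qed.

Lemma at_rank_sep2 x0 : at_rank j x0 (last_sep k (key j v) i) = sep2.
Proof. by rewrite -key_sep2 at_rank_key. Qed.

Lemma at_rank_sep1 x0 : at_rank j x0 (first_sep k (key j u) i) = sep1.
Proof. by rewrite -key_sep1 at_rank_key. Qed.

Lemma suitableE : suitable (table_data u) (label_data v) (val j, i) <->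
  exists l, adj j l u v.
Proof.
rewrite /suitable rank_table rank_label sep_table // sep_label // split /=.
rewrite !nth_mkseq ?ltn_pmod ?(ltnW k_gt1) //.
rewrite (sibling_last_sep split) (sibling_first_sep split).
rewrite !at_rank_sep1 !at_rank_sep2 -/sep1.
have h := adj_labelP (cover_adj cov j) (key_lt_card j) (ltnW key_u_sep1)
  key_sep12 key_sep2_v.
exact: iff_sym h.
Qed.

Lemma sibling_port_sep2 :
  nth 0 (sibling_ports (table_data sep1) (val j)) (key j v %/ k ^ i %% k) =
  port_to sep1 sep2.
Proof.
rewrite /sibling_ports nth_enum_map /= nth_mkseq ?ltn_pmod ?(ltnW k_gt1) //.
rewrite !key_sep1 (sep_level_first_sep k_gt1 iD split).
rewrite /sibling_sep (first_sep_div k_gt1 split) divk_expS -divn_eq.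
by rewrite at_rank_sep2.
Qed.

End Pair.

Lemma vertex_name_inj : injective vertex_name.
Proof. by move=> x y /val_inj/enum_rank_inj. Qed.

Lemma forward_scheme u v w :
  forward (rules m) (table scheme w) (packet_header (rules m) scheme u v) =
  next_port (table_data w) (aux_data m (table_data u) (label_data v)).
Proof.
rewrite /= /read_aux /read_vertex.
rewrite (decodeK _ (prefix_code_seq prefix_code_nat)).
by rewrite !(decodeK _ prefix_code_vertex).
Qed.

(** The cover supplies one suitable order, so the search succeeds; it may stop at another one, which
    [suitableE] shows to be good as well. *)
Lemma ex_split u v : u != v -> exists (j : 'I_m) (i : nat),
  [/\ i < D, splits_at k (key j u) (key j v) i, (exists l, adj j l u v)
    & choose_split m (table_data u) (label_data v) = (val j, i)].
Proof.
move=> uv; have [j [l uvl]] := cover_ex cov uv.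
have kuv := adj_lt (cover_adj cov j) uvl.
have [i iD sij] := ex_splits_at k_gt1 kuv (leq_trans (key_lt_card j v) V_le).
have := @choose_splitP m (table_data u) (label_data v) j i (ltn_ord j) iD.
case; first by apply/suitableE => //; exists l.
case: choose_split => j' i' /= j'm i'D suit.
have sp : splits_at k (key (Ordinal j'm) u) (key (Ordinal j'm) v) i'.
  move: suit => /andP[].
  by rewrite -[j']/(val (Ordinal j'm)) rank_table rank_label.
exists (Ordinal j'm), i'; split=> //.
by apply/(suitableE i'D sp).
Qed.

Lemma scheme_route u v : exists s,
  [/\ routed_path (rules m) P scheme u v s, size s <= 3
    & (path_length M u s <= (1 + 4 * e) * M u v)%R].
Proof.
have := forward_scheme u v; rewrite /routed_path.
move: (rules m) scheme => A S; move: (packet_header A S u v) => h fwdE.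
have [euv|uv] := eqVneq u v.
  exists [::]; rewrite /= euv eqxx dist_xx mulr0 fwdE /aux_data /next_port.
  by rewrite euv /= eqxx /= eqxx.
have [j [i [iD sp [l adj_uv] hch]]] := ex_split uv.
have fwd w : forward A (table S w) h =
    if w == v then None
    else if w == sep2 v j i then Some (port_to (sep2 v j i) v)
    else if w == sep1 u j i then
      Some (nth 0 (sibling_ports (table_data w) (val j))
              (key j v %/ k ^ i %% k))
    else Some (port_to u (sep1 u j i)).
  rewrite fwdE /aux_data hch /next_port (inj_eq vertex_name_inj) (negPf uv) /=.
  rewrite -[nat_of_ord j]/(val j) rank_label sep_table // sep_label //.
  by rewrite !(inj_eq vertex_name_inj).
have k1 := key_u_sep1 sp; have k2 := key_sep12 sp; have k3 := key_sep2_v v j i.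
have len := adjacency_detour e_ge0 cov adj_uv (ltnW k1) k2 k3.
have sib := sibling_port_sep2 iD sp.
move: (sep1 u j i) (sep2 v j i) fwd k1 k2 k3 len sib => s1 s2 fwd.
move=> k1 k2 k3 len sib.
have us1 : u != s1 by apply: contraTneq k1 => <-; rewrite ltnn.
have us2 : u != s2.
  by apply: contraTneq k1 => ->; rewrite -leqNgt.
have hopP w w' : w != w' ->
    forward A (table S w) h = Some (port_to w w') ->
    hop A P S h w w'.
  by move=> ww' E; rewrite /hop /= ww' E /port_to (negPf ww') eqxx.
have fv : forward A (table S v) h = None by rewrite fwd eqxx.
have hu : hop A P S h u s1.
  by apply: hopP; rewrite // fwd (negPf uv) (negPf us2) (negPf us1).
have h2 : s2 != v -> hop A P S h s2 v.
  by move=> s2v; apply: hopP; rewrite // fwd (negPf s2v) eqxx.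
have h1 : s1 != v -> s1 != s2 -> hop A P S h s1 s2.
  move=> s1v s12; apply: hopP => //.
  by rewrite fwd (negPf s1v) (negPf s12) eqxx sib.
(* Overlay edges join distinct vertices, so coincidences among [s1], [s2] and [v] are treated
   separately; [s1 = v] forces [s2 = v]. *)
have [e1|s1v] := eqVneq s1 v.
  exists [:: v]; rewrite /= -e1 hu /= e1 eqxx fv; split=> //.
  have e2 : s2 = v.
    apply: (cover_key_inj cov (j := j)); apply/eqP; rewrite eqn_leq k3.
    by rewrite -e1 k2.
  by move: len; rewrite e1 e2 !dist_xx !addr0.
have [e2|s2v] := eqVneq s2 v.
  exists [:: s1; v]; rewrite /= hu -{1}e2 h1 ?e2 // eqxx fv; split=> //.
  by move: len; rewrite e2 dist_xx.
have [e12|s12] := eqVneq s1 s2.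
  exists [:: s1; v]; rewrite /= hu e12 h2 // eqxx fv; split=> //.
  by move: len; rewrite e12 dist_xx add0r addr0.
exists [:: s1; s2; v]; rewrite /= hu h1 // h2 // eqxx fv; split=> //.
by rewrite addr0.
Qed.

Lemma scheme_delivers : delivers (rules m) P scheme.
Proof. by move=> u v; have [s [h _ _]] := scheme_route u v; exists s. Qed.

Lemma scheme_hop_bounded : hop_bounded (rules m) P scheme 3.
Proof.
move=> u v s hs; have [s' [h sz _]] := scheme_route u v.
by rewrite (routed_path_uniq hs h).
Qed.

Lemma scheme_stretch : has_stretch M (rules m) P scheme (1 + 4 * e).
Proof.
move=> u v s hs; have [s' [h _ len]] := scheme_route u v.
by rewrite (routed_path_uniq hs h).
Qed.

(** * Bit counts of tables, labels and headers *)

Section Size.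
Variable W : nat.
Hypotheses (V_W : #|V| < 2 ^ W) (k_W : k < 2 ^ W) (D_W : D < 2 ^ W)
  (m_W : m < 2 ^ W).

Definition sep_cost : nat := 3 * W.*2.+1 + (k * 2).+1.
Definition order_cost : nat :=
  W.*2.+1 + (k * W.*2.+2).+1 + (D * sep_cost.+1).+1.
Definition vertex_cost : nat := 3 * W.*2.+1 + (m * order_cost.+1).+1.

Lemma vertex_name_W x : vertex_name x < 2 ^ W.
Proof. exact: ltn_trans (ltn_ord _) V_W. Qed.

Lemma port_to_W x y : port_to x y < 2 ^ W.
Proof.
rewrite /port_to; case: eqVneq => [_|xy]; first by rewrite expn_gt0.
apply: ltn_trans V_W; apply: leq_trans (max_card _).
by apply: port_lt_deg.
Qed.

Lemma key_W j x : key j x < 2 ^ W.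
Proof. exact: ltn_trans (key_lt_card j x) V_W. Qed.

Lemma right_bound_W j u s : right_bound (key j) (adj j) u s < 2 ^ W.
Proof.
apply: leq_ltn_trans V_W; apply/bigmax_leqP => v _; exact: key_lt_card.
Qed.

Lemma left_bound_W j s v : left_bound (key j) (adj j) s v < 2 ^ W.
Proof. by apply: leq_ltn_trans V_W; rewrite /left_bound leq_subr. Qed.

Lemma size_code_sep (s : sep_data) (f : nat -> bool) :
  sep_name s < 2 ^ W -> sep_port s < 2 ^ W -> sep_bound s < 2 ^ W ->
  sep_bits s = mkseq f k -> size (code_sep s) <= sep_cost.
Proof.
case: s => [[[a b] c] d]; rewrite /sep_name /sep_port /sep_bound /sep_bits /=.
move=> /size_code_nat ha /size_code_nat hb /size_code_nat hc ->.
rewrite /code_sep /code_pair /= !size_cat /sep_cost.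
have := @size_code_seq _ _ code_bool f (iota 0 k) 1 (fun=> isT).
by rewrite size_iota -/(mkseq f k); lia.
Qed.

Lemma size_code_table u : size (code_vertex (table_data u)) <= vertex_cost.
Proof.
rewrite /code_vertex /table_data /code_pair /= !size_cat /vertex_cost.
have hk := size_code_nat k_W; have hD := size_code_nat D_W.
have hu := size_code_nat (vertex_name_W u).
apply: leq_add; first by lia.
rewrite -[X in X * _](size_enum_ord m); apply: size_code_seq => j.
 rewrite /code_order /code_pair /= !size_cat /order_cost.
apply: leq_add; first apply: leq_add.
- exact: size_code_nat (key_W j u).
- rewrite -[X in X * _](size_iota 0 k); apply: size_code_seq => b.
  exact: size_code_nat (port_to_W _ _).
rewrite -[X in X * _](size_iota 0 D); apply: size_code_seq => i.
apply: size_code_sep; last reflexivity.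
- exact: vertex_name_W.
- exact: port_to_W.
- exact: right_bound_W.
Qed.

Lemma size_code_label u : size (code_vertex (label_data u)) <= vertex_cost.
Proof.
rewrite /code_vertex /label_data /code_pair /= !size_cat /vertex_cost.
have hk := size_code_nat k_W; have hD := size_code_nat D_W.
have hu := size_code_nat (vertex_name_W u).
apply: leq_add; first by lia.
rewrite -[X in X * _](size_enum_ord m); apply: size_code_seq => j.
 rewrite /code_order /code_pair /= !size_cat /order_cost.
apply: leq_add; first apply: leq_add => //.
- exact: size_code_nat (key_W j u).
rewrite -[X in X * _](size_iota 0 D); apply: size_code_seq => i.
apply: size_code_sep; last reflexivity.
- exact: vertex_name_W.
- exact: port_to_W.
- exact: left_bound_W.
Qed.

Lemma vertex_bits_scheme u : vertex_bits scheme u <= 2 * vertex_cost.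
Proof.
rewrite /vertex_bits mul2n -addnn.
by apply: leq_add; [exact: size_code_table | exact: size_code_label].
Qed.

Lemma header_bits_scheme u v :
  header_bits (rules m) scheme u v <= vertex_cost + (7 * W.*2.+2).+1.
Proof.
apply: leq_add; first exact: size_code_label.
rewrite /= /read_vertex !(decodeK _ prefix_code_vertex).
have c n : n < 2 ^ W -> size (code_nat n) <= W.*2.+1 := @size_code_nat n W.
have [uv|uv] := eqVneq u v.
  rewrite uv /aux_data eqxx /= size_cat /=.
  by have := c _ (vertex_name_W v); rewrite /name /=; lia.
have [j [i [iD sp _ hch]]] := ex_split uv.
rewrite /aux_data hch (inj_eq vertex_name_inj) (negPf uv).
rewrite rank_label sep_table // sep_label //.
rewrite /name /sep_name /sep_port /radix /=.
do 7 rewrite size_cat /=.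
have := c _ (vertex_name_W v).
have := c _ (vertex_name_W (at_rank j v (last_sep k (key j v) i))).
have := c _ (port_to_W (at_rank j v (last_sep k (key j v) i)) v).
have := c _ (vertex_name_W (at_rank j u (first_sep k (key j u) i))).
have := c _ (port_to_W u (at_rank j u (first_sep k (key j u) i))).
have := c _ (ltn_trans (ltn_ord j) m_W).
have := c _ (ltn_trans (ltn_pmod (key j v %/ k ^ i) (ltnW k_gt1)) k_W).
by lia.
Qed.

End Size.

End Scheme.

(** * Space bounds *)

Section RadixChoice.
Local Open Scope nat_scope.

Definition bitlen (n : nat) : nat := (trunc_log 2 n).+1.

(* The radix is [2 ^ radix_log n], about the square root of [log2 n]: the ports
   to all siblings and the bits of all levels then fit in the space bound. *)
Definition radix_log (n : nat) : nat := (trunc_log 2 (bitlen n))./2.+1.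

Definition levels (n : nat) : nat := (bitlen n %/ radix_log n).+1.

Lemma ltn_bitlen n : n < 2 ^ bitlen n.
Proof. exact: trunc_log_ltn. Qed.

Lemma radix_log_le n : radix_log n <= bitlen n.
Proof.
have := trunc_logP (p := 2) (n := bitlen n) isT isT.
have := ltn_expl (trunc_log 2 (bitlen n)) (ltnSn 1).
by rewrite /radix_log; move: (trunc_log 2 (bitlen n)) => l; lia.
Qed.

Lemma sqr_radix_le n : 2 ^ radix_log n * 2 ^ radix_log n <= 4 * bitlen n.
Proof.
have h := trunc_logP (p := 2) (n := bitlen n) isT isT.
rewrite -expnD /radix_log addSn addnS addnn !expnS mulnA leq_mul2l /=.
apply: leq_trans h; rewrite leq_exp2l //.
by move: (trunc_log _ _) => l; lia.
Qed.

Lemma radix_radix_log_le n : 2 ^ radix_log n * radix_log n <= 4 * bitlen n.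
Proof.
apply: leq_trans (sqr_radix_le n); rewrite leq_mul2l ltnW ?orbT //.
exact: ltn_expl.
Qed.

Lemma radix_le n : 2 ^ radix_log n <= 4 * bitlen n.
Proof.
by apply: leq_trans (radix_radix_log_le n); rewrite leq_pmulr.
Qed.

Lemma levels_radix_log_le n : levels n * radix_log n <= 2 * bitlen n.
Proof.
rewrite /levels mulSn mul2n -addnn; apply: leq_add; first exact: radix_log_le.
exact: leq_trunc_div.
Qed.

Lemma radix_levels_gt n : n < (2 ^ radix_log n) ^ levels n.
Proof.
apply: leq_trans (ltn_bitlen n) _; rewrite -expnM leq_exp2l // mulnC.
by rewrite /levels; apply: ltnW; apply: ltn_ceil.
Qed.

Lemma radix_gt1 n : 1 < 2 ^ radix_log n.
Proof. by rewrite -{1}(expn0 2) ltn_exp2l. Qed.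

(** Multiplying by [radix_log n] replaces division by log log n. Up to constants, an order costs
    [k * W] bits for sibling ports and [D * (W + k)] for levels, and both [k * radix_log n] and
    [D * radix_log n] are O([bitlen n]). *)
Lemma cost_le m n :
  let W := bitlen n + m.+1 in
  (2 * vertex_cost m (2 ^ radix_log n) (levels n) W + (7 * W.*2.+2).+1)
    * radix_log n <= 2000 * m.+1 ^ 3 * bitlen n ^ 2.
Proof.
have w1 : 0 < bitlen n by [].
have := radix_log_le n; have := radix_radix_log_le n; have := radix_le n.
have := levels_radix_log_le n.
rewrite /vertex_cost /order_cost /sep_cost.
move: (bitlen n) (radix_log n) (2 ^ radix_log n) (levels n) w1 => w a k D w1.
move=> Da kw ka aw; set W := w + m.+1; set X := m.+1 * w.
have WX : W <= 2 * X by rewrite /W /X; nia.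
have wX : w <= X by rewrite /X; nia.
have -> : 2000 * m.+1 ^ 3 * w ^ 2 = 2000 * (m.+1 * (X * X)).
  by rewrite /X; ring.
have fieldX : W.*2.+2 <= 6 * X by lia.
have hports : k * W.*2.+2 * a <= 24 * (X * X).
  rewrite mulnAC; apply: leq_trans (leq_mul ka fieldX) _.
  by rewrite mulnACA leq_mul2l leq_mul2r wX orbT.
set S := (3 * W.*2.+1 + _).+1.
have hS : S <= 25 * X by rewrite /S; lia.
have hseps : D * S * a <= 50 * (X * X).
  rewrite mulnAC; apply: leq_trans (leq_mul Da hS) _.
  by rewrite mulnACA leq_mul2l leq_mul2r wX orbT.
have XX : X <= X * X by rewrite leq_pmulr // (leq_trans w1).
set O := (_ + (k * _).+1 + _).+1.
have hfield : W.*2.+2 * a <= 6 * (X * X).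
  by rewrite mulnA; apply: leq_mul => //; exact: leq_trans wX.
have hO : O * a <= 90 * (X * X).
  by move: hports hseps hfield; rewrite /O; lia.
have hmO : m * O * a <= 90 * (m.+1 * (X * X)).
  rewrite -mulnA; apply: leq_trans (leq_mul (leqnSn m) hO) _.
  by rewrite mulnCA.
have mX : X * X <= m.+1 * (X * X) by rewrite leq_pmull.
move: hfield hmO mX; move: (m.+1 * (X * X)) (X * X) XX => Y Z; lia.
Qed.

End RadixChoice.

(** For [2 < n], [bitlen n] is at most twice [log2 n] and [log2 (log2 n)] at most twice
    [radix_log n], whence 8 = 4 * 2. For smaller [n], [bitlen n <= 2] gives [b <= 4 * c]. *)
Lemma log_sq_bound (R : realType) (n b c : nat) :
  (b * radix_log n <= c * bitlen n ^ 2)%N ->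
  b%:R <= (8 * c)%:R * log_sq_over_loglog R n.
Proof.
move=> h; rewrite /log_sq_over_loglog; case: leqP => n2.
  have bc : (b <= 8 * c)%N.
    have : (bitlen n <= 2)%N.
      rewrite /bitlen ltnS -(@trunc_expnK 2 1) // leq_trunc_log //.
    move=> w2; have : (b <= b * radix_log n)%N by rewrite leq_pmulr.
    have : (bitlen n ^ 2 <= 2 ^ 2)%N by rewrite leq_exp2r.
    by nia.
  by rewrite mulr1 ler_nat.
have l2 : 0 < ln 2 :> R by rewrite ln_gt0 // ltr1n.
have n0 : 0 < n%:R :> R by rewrite ltr0n; lia.
pose L : R := log2 n%:R.
have ln_pow i : ln (2 ^+ i : R) = i%:R * ln 2 by rewrite lnXn // mulr_natl.
have wL : (bitlen n)%:R - 1 <= L.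
  rewrite /L /log2 ler_pdivlMr // /bitlen -addn1 natrD addrK -ln_pow.
  rewrite ler_ln ?posrE //.
    by rewrite -natrX ler_nat trunc_logP //; lia.
  by rewrite exprn_gt0.
have Lw : L < (bitlen n)%:R.
  rewrite /L /log2 ltr_pdivrMr // -ln_pow ltr_ln ?posrE // ?exprn_gt0 //.
  by rewrite -natrX ltr_nat ltn_bitlen.
have L1 : 1 < L.
  by rewrite /L /log2 ltr_pdivlMr // mul1r ltr_ln ?posrE // ltr_nat.
have LL0 : 0 < log2 L by rewrite /log2 divr_gt0 // ln_gt0.
have LLa : log2 L <= 2 * (radix_log n)%:R.
  rewrite /log2 ler_pdivrMr // -(natrM _ 2) -ln_pow ler_ln ?posrE ?exprn_gt0 //.
    apply: le_trans (ltW Lw) _; rewrite -natrX ler_nat.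
    apply: leq_trans (ltnW (ltn_bitlen _)) _; rewrite leq_exp2l //.
    by rewrite {1}/bitlen /radix_log; move: (trunc_log _ _) => l; lia.
  by lra.
rewrite mulrA ler_pdivlMr //.
have hR : b%:R * (radix_log n)%:R <= c%:R * (bitlen n)%:R ^+ 2 :> R.
  by rewrite -natrX -!natrM ler_nat.
have b0 : 0 <= b%:R :> R by [].
have c0 : 0 <= c%:R :> R by [].
have hb := ler_wpM2l b0 LLa.
have w2 : (bitlen n)%:R <= 2 * L by lra.
have w0 : 0 <= (bitlen n)%:R :> R by [].
have hw : (bitlen n)%:R ^+ 2 <= 4 * L ^+ 2 by rewrite !expr2; nra.
have := ler_wpM2l c0 hw; rewrite natrM -/L.
by lra.
Qed.

Lemma doubling_half_coverable (R : realType) (d : R) : exists k : nat,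
  forall (V : finType) (M : finite_metric R V),
    doubling_dimension M <= d -> half_coverable M k.
Proof.
(* This is a natural number above [2 ^ d], independent of the metric. *)
exists (Num.bound (expR (d * ln 2))) => V M.
rewrite /doubling_dimension /doubling_constant.
case: ex_minnP => c /asboolP hc _ hd x r r0.
have [C hC sC] := hc x r r0; exists C => //; apply: (leq_trans hC).
have [->//|c0] := posnP c.
have l2 : 0 < ln 2 :> R by rewrite ln_gt0 // ltr1n.
rewrite -(ler_nat R); apply: le_trans (ltW (archi_boundP (expR_ge0 _))).
rewrite -[X in X <= _]lnK ?posrE ?ltr0n // ler_expR.
by rewrite -ler_pdivrMr.
Qed.

Theorem theorem1p10 (R : realType) (eps d : R) (heps : 0 < eps < 1) :
  exists (C : R) (A : routing_rules),
    forall (n : nat) (V : finType) (M : finite_metric R V),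
      #|V| = n -> doubling_dimension M <= d ->
      exists E : overlay V, forall P : port_numbering E,
        exists S : assignment V,
          [/\ delivers A P S,
              hop_bounded A P S 3,
              has_stretch M A P S (1 + eps),
              forall u : V,
                (vertex_bits S u)%:R <= C * log_sq_over_loglog R n
            & forall u v : V,
                (header_bits A S u v)%:R <= C * log_sq_over_loglog R n].
Proof.
have [K hK] := doubling_half_coverable d.
(* The division by 4 offsets the factor in [adjacency_detour]. *)
have e0 : 0 < eps / 4 by case/andP: heps => ? _; rewrite divr_gt0.
have [m hm] := ex_adjacency_cover K e0.
(* The factor 8 comes from [log_sq_bound], the rest from [cost_le]; [m] was fixed by [eps] and [d]
   before the metric. *)
exists (8 * (2000 * m.+1 ^ 3))%:R, (rules m) => n V M Vn hd.
have [key [adj cov]] := hm V M (hK V M hd).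
exists (complete_overlay V) => P.
pose krank j := key_rank (key j).
have kcov := key_rank_cover cov.
have klt j x : (krank j x < #|V|)%N by exact: key_rank_lt_card.
pose k := (2 ^ radix_log n)%N; pose D := levels n.
have k1 : (1 < k)%N by exact: radix_gt1.
have VD : (#|V| <= k ^ D)%N by rewrite Vn ltnW // radix_levels_gt.
exists (scheme krank adj k D P).
pose W := (bitlen n + m.+1)%N.
have cost := cost_le m n; rewrite -/W -/k -/D /= in cost.
have powW i : (i <= W)%N -> (2 ^ i <= 2 ^ W)%N by move=> h; rewrite leq_exp2l.
have V_W : (#|V| < 2 ^ W)%N.
  by rewrite Vn; apply: leq_trans (ltn_bitlen n) (powW _ (leq_addr _ _)).
have k_W : (k < 2 ^ W)%N.
  by rewrite ltn_exp2l // /W; have := radix_log_le n; lia.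
have D_W : (D < 2 ^ W)%N.
  apply: leq_ltn_trans (_ : _ <= W)%N (ltn_expl _ _) => //.
  by have := leq_div (bitlen n) (radix_log n); rewrite /D /levels /W; lia.
have m_W : (m < 2 ^ W)%N.
  by apply: leq_ltn_trans (_ : _ <= W)%N (ltn_expl _ _) => //; rewrite /W; lia.
have e0' := ltW e0.
split.
- exact: (scheme_delivers e0' kcov klt k1 VD P).
- exact: (scheme_hop_bounded e0' kcov klt k1 VD).
- have -> : eps = 4 * (eps / 4) by rewrite mulrC divfK // pnatr_eq0.
  exact: (scheme_stretch e0' kcov klt k1 VD).
- move=> u; apply: log_sq_bound; apply: leq_trans cost; rewrite leq_mul2r.
  apply/orP; right; apply: leq_trans (leq_addr _ _).
  exact: (vertex_bits_scheme adj e0' klt k1 VD P V_W k_W D_W m_W u).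
- move=> u v; apply: log_sq_bound; apply: leq_trans cost; rewrite leq_mul2r.
  apply/orP; right.
  have := header_bits_scheme e0' kcov klt k1 VD P V_W k_W D_W m_W u v.
  move=> h; apply: (leq_trans h).
  by rewrite leq_add2r leq_pmull.
Qed.
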